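(* Let $\mu=(\mu_1,\mu_2)\in\mathbb{R}^2$ with $\Delta=|\mu_1-\mu_2|>0$ and let $T\ge 1$ be an integer. For all $\epsilon\in(0,\Delta)$, if $T(\Delta-\epsilon)^2 \geq 2$ and $T\epsilon^2 \geq e^2$, the regret of the UCB$^*$ strategy is upper bounded as $$R^{\mathrm{UCB}^*}_\mu(T) \leq \frac{2\log\left(\frac{T\Delta^2}{2}\right)}{\Delta\left(1 - \frac{\epsilon}{\Delta}\right)^2} + \frac{2\sqrt{\pi\log\left(\frac{T\Delta^2}{2}\right)}}{\Delta\left(1 - \frac{\epsilon}{\Delta}\right)^2} + \Delta\left(\frac{30e \sqrt{\log(\epsilon^2 T)}+16e}{\epsilon^2} \right) + \frac{2}{\Delta\left(1 - \frac{\epsilon}{\Delta}\right)^2} +\Delta .$$ Moreover, $\limsup_{T\to\infty} R^{\mathrm{UCB}^*}_\mu(T) / \log(T) = 2/\Delta$, and for all $\mu\in\mathbb{R}^2$ (with $\Delta=|\mu_1-\mu_2|$), $R_\mu^{\mathrm{UCB}^*}(T) \leq 33 \sqrt{T} + \Delta$.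
   Context: Two-armed Gaussian bandit with known integer horizon $T$: at each time $t\in\{1,\dots,T\}$ the agent chooses $A_t\in\{1,2\}$ based on past observations and receives a reward $Z_t\sim\mathcal N(\mu_{A_t},1)$, where successive rewards from each arm are i.i.d. and the two arms are independent. Expectation under $\mu$ is denoted $\mathbb{E}_\mu$. The regret of a strategy $\pi$ is $R^\pi_\mu(T) = T \max\{\mu_1, \mu_2\} - \mathbb{E}_\mu\left[\sum_{t=1}^T \mu_{A_t}\right]$. $N_i(t)=\sum_{s=1}^t\mathbf{1}\{A_s=i\}$ is the number of draws of arm $i$ up to time $t$, and $\hat\mu_i(t)$ is the empirical mean of the rewards obtained from arm $i$ up to time $t$. UCB$^*$ strategy (input $T$): at each $t\in\{1,\dots,T\}$ choose $$A_t = \operatorname{argmax}_{i \in \{1,2\}} \ \hat \mu_i(t-1) + \sqrt{\frac{2}{N_i(t-1)} \log\left(\frac{T}{N_i(t-1)}\right)},$$ where the index of an arm with $N_i(t-1)=0$ is $+\infty$ by convention and ties are broken arbitrarily. *)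

(* Defs.v *)
From HB Require Import structures.
From mathcomp Require Import all_boot all_order all_algebra.
From mathcomp Require Import all_classical all_reals all_analysis.

Set Implicit Arguments.
Unset Strict Implicit.
Unset Printing Implicit Defensive.

Import Order.TTheory GRing.Theory Num.Theory.
Import numFieldNormedType.Exports.

Local Open Scope classical_set_scope.
Local Open Scope ring_scope.

(* The arms are indexed by ['I_2] (0 and 1 instead of 1 and 2).  A history lists
   the past pairs (A_s, Z_s), oldest first. *)
Definition history (R : realType) := seq ('I_2 * R).

(* The first argument is an exogenous source of randomness, which a strategy
   may use (typically to break ties); deterministic strategies ignore it. *)
Definition strategy (V : Type) (R : realType) := V -> history R -> 'I_2.

Definition measurable_strategy (R : realType) (d : measure_display)
    (V : measurableType d) (p : strategy V R) :=
  forall (t : nat) (a : t.-tuple 'I_2) (i : 'I_2),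
    measurable [set x : V * t.-tuple R |
                p x.1 (zip a x.2) = i].

Definition draws (R : realType) (h : history R) (i : 'I_2) : nat :=
  count (fun az => az.1 == i) h.

Definition empirical_mean (R : realType) (h : history R) (i : 'I_2) : R :=
  (\sum_(az <- h | az.1 == i) az.2) / (draws h i)%:R.

Definition ucb_star_index (R : realType) (T : nat) (h : history R) (i : 'I_2)
    : \bar R :=
  let N : R := (draws h i)%:R in
  if draws h i == 0%N then +oo%E
  else (empirical_mean h i + Num.sqrt (2 / N * ln (T%:R / N)))%:E.

(* The argmax need not be unique: any measurable selection is allowed. *)
Definition ucb_star (R : realType) (d : measure_display) (V : measurableType d)
    (T : nat) (p : strategy V R) :=
  measurable_strategy p /\
  forall (u : V) (h : history R), (size h < T)%N ->
    forall i, (ucb_star_index T h i <= ucb_star_index T h (p u h))%E.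

(* [x i s] is the reward produced by the (s+1)-st draw of arm i. *)
Fixpoint play (V : Type) (R : realType) (p : strategy V R) (u : V)
    (x : 'I_2 -> nat -> R) (t : nat) : history R :=
  if t is t'.+1 then
    let h := play p u x t' in
    let a := p u h in rcons h (a, x a (draws h a))
  else [::].

Definition independent_systems (R : realType) (d : measure_display)
    (Omega : measurableType d) (P : probability Omega R) (I : eqType)
    (F : I -> set_system Omega) :=
  forall (s : seq I) (E : I -> set Omega), uniq s ->
    (forall i, i \in s -> F i (E i)) ->
    P (\bigcap_(i in [set` s]) E i) = (\prod_(i <- s) P (E i))%E.

Definition gaussian_bandit (R : realType) (d : measure_display)
    (Omega : measurableType d) (P : probability Omega R) (d' : measure_display)
    (V : measurableType d') (mu : 'I_2 -> R) (X : 'I_2 -> nat -> {RV P >-> R})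
    (U : {mfun Omega >-> V}) :=
  (forall i s (B : set R), measurable B ->
     distribution P (X i s) B = normal_prob (mu i) 1 B) /\
  independent_systems P (fun k : option ('I_2 * nat) =>
    if k is Some (i, s) then preimage_set_system setT (X i s) measurable
    else preimage_set_system setT U measurable).

(* The round t+1 is played after the history of the first t rounds. *)
Definition action (R : realType) (d : measure_display)
    (Omega : measurableType d) (P : probability Omega R) (d' : measure_display)
    (V : measurableType d') (X : 'I_2 -> nat -> {RV P >-> R})
    (U : {mfun Omega >-> V}) (p : strategy V R) (t : nat) (w : Omega) : 'I_2 :=
  p (U w) (play p (U w) (fun i s => X i s w) t).

(* The integrand is bounded, so the expectation is finite and [fine] is
   harmless. *)
Definition regret (R : realType) (d : measure_display)
    (Omega : measurableType d) (P : probability Omega R) (d' : measure_display)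
    (V : measurableType d') (mu : 'I_2 -> R) (X : 'I_2 -> nat -> {RV P >-> R})
    (U : {mfun Omega >-> V}) (p : strategy V R) (T : nat) : R :=
  T%:R * Num.max (mu 0) (mu 1) -
  fine ('E_P[fun w => (\sum_(t < T) mu (action X U p t w))%R])%E.

(* Main.v *)
Require Import Defs.
From HB Require Import structures.
From mathcomp Require Import all_boot all_order all_algebra.
From mathcomp Require Import all_classical all_reals all_analysis.
From mathcomp Require Import measurable_realfun ring lra zify.
Import Order.TTheory GRing.Theory Num.Theory.
Import numFieldNormedType.Exports.

Set Implicit Arguments.
Unset Strict Implicit.
Unset Printing Implicit Defensive.

Local Open Scope classical_set_scope.
Local Open Scope ring_scope.

(** Call [b] the best arm, [o] the other one and [De] the gap. A round costs
    [De] when [o] is drawn and nothing otherwise, so the regret is [De] times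
    the expected number of draws of [o] (lemma [regretE]), and all three claims
    are bounds on that expectation.

    The rewards of an arm are read off a stack that is fixed in advance, and the
    index of an arm depends only on its stack and on its number of draws
    ([stack_index]). Everything that has to be known about a trajectory
    therefore follows from events on the two stacks, whatever the interleaving
    of the draws and the way ties are broken. Each of these events says that the
    centered partial sums [S s] of one arm, or their opposites, cross some
    curve, and one estimate controls them all: for every real [lam], the sums
    [lam * S s] ever reach [c + s * lam ^ 2 / 2] with probability at most
    [exp (- c)] ([line_crossing]). This is Ville's maximal inequality for the
    exponential martingale of a Gaussian walk.

    Upper bound. Fix [eps] and put [de := De - eps]. As long as the index of [b]
    stays above [mu b - eps], the arm [o] is drawn a further time only when its
    own index, after the current number of draws, is at least [mu b - eps =
    mu o + de]. Hence ([expected_draws_upper]) the expected number of draws is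
    at most [1], plus [T] times the probability that the index of [b] ever falls
    below [mu b - eps], plus the sum over [s] of the probability that the index
    of [o] after [s] draws reaches [mu o + de].

    - The index of [b] falls below [mu b - eps] after [s] draws when a centered
      sum exceeds [eps * s + sqrt (2 * s * ln (T / s))]. This curve lies above
      an envelope of lines, one for each cell of a geometric grid of ratio
      [r ^ 4] ([line_below_boundary]). A line tangent to a square root leaves it
      only to second order, so [r - 1] may be of order [1 / sqrt L] with
      [L := ln (T * eps ^ 2)]; this is where [sqrt L] comes from, as the number
      of cells per unit of logarithmic scale. The exceptional probabilities of
      the lines sum up ([grid_sum]) to less than
      [(48 * sqrt L + 24) / (T * eps ^ 2)].

    - For [o], the Chernoff bound gives the tail [exp (- v ^ 2)] with
      [v := de * sqrt (s / 2) - sqrt A] and [A := ln (T * De ^ 2 / 2)] as soon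
      as [v] is positive; the sum over [s] is dominated by a Gaussian integral,
      and is at most [(2 * A + 2 + 2 * sqrt (pi * A)) / de ^ 2]
      ([tail_sum]).

    Since [e >= 2], the two constants are below those of the first claim. The
    last claim is trivial if [De * sqrt T <= 33], and otherwise is the upper
    bound with [eps := De / 2]. Letting [eps] be a small multiple of [De] gives
    the upper half of the asymptotic claim.

    Lower bound. With probability close to one, all centered sums of [b] stay
    below [zeta * s + K] and all those of [o] stay above [- (zeta * s + K)].
    If [o] were then drawn less than [nu := c * ln T] times, the arm [b] would
    be drawn in some round after at least [T / 2] draws. At that round its
    index is at most [mu b + 2 * zeta], while the index of [o], which has
    been drawn less than [nu] times, is larger if [c < 2 / De ^ 2] and [T] is
    large: a contradiction ([draws_lower]). *)

(** * A maximal inequality for independent factors of mean one *)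

(** The joint law of [f] and [g] agrees with the product of their laws on
    rectangles, hence everywhere; Fubini-Tonelli then separates the variables. *)
Lemma ge0_expectation_indep (R : realType) (d d1 d2 : measure_display)
    (Omega : measurableType d) (P : probability Omega R)
    (T1 : measurableType d1) (T2 : measurableType d2)
    (f : Omega -> T1) (g : Omega -> T2) (F : T1 -> R) (G : T2 -> R) :
  measurable_fun setT f -> measurable_fun setT g ->
  (forall A B, measurable A -> measurable B ->
     (P (f @^-1` A `&` g @^-1` B) = P (f @^-1` A) * P (g @^-1` B))%E) ->
  measurable_fun setT F -> measurable_fun setT G ->
  (forall x, 0 <= F x) -> (forall y, 0 <= G y) ->
  (\int[P]_w (F (f w) * G (g w))%:E =
   \int[P]_w (F (f w))%:E * \int[P]_w (G (g w))%:E)%E.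
Proof.
move=> mf mg fg mF mG F0 G0.
pose f' : {mfun Omega >-> T1} := HB.pack f (isMeasurableFun.Build _ _ _ _ _ mf).
pose g' : {mfun Omega >-> T2} := HB.pack g (isMeasurableFun.Build _ _ _ _ _ mg).
have mfg : measurable_fun setT (fun w => (f w, g w)).
  exact: measurable_fun_pair.
pose h' : {mfun Omega >-> (T1 * T2)%type} :=
  HB.pack (fun w => (f w, g w)) (isMeasurableFun.Build _ _ _ _ _ mfg).
have joint (X : set (T1 * T2)) : measurable X ->
    ((distribution P f' \x distribution P g') X = distribution P h' X)%E.
  apply: product_measure_unique => A B mA mB /=.
  by rewrite -fg.
pose FG (z : T1 * T2) : \bar R := (F z.1 * G z.2)%:E.
have mFG : measurable_fun setT FG.
  apply/measurable_EFinP; apply: measurable_funM.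
  - exact: (measurableT_comp mF measurable_fst).
  - exact: (measurableT_comp mG measurable_snd).
have FG0 z : (0 <= FG z)%E by rewrite lee_fin mulr_ge0.
have -> : (\int[P]_w (F (f w) * G (g w))%:E = \int[distribution P h']_z FG z)%E.
  by rewrite ge0_integral_distribution.
have -> : (\int[distribution P h']_z FG z =
    \int[distribution P f' \x distribution P g']_z FG z)%E.
  by apply: eq_measure_integral => A mA _; exact/esym/joint.
rewrite fubini_tonelli1//= /fubini_F /=.
under eq_integral => x _.
  rewrite /FG /=; under eq_integral => y _ do rewrite EFinM.
  rewrite ge0_integralZl//; first over.
  - by apply/measurable_EFinP.
  - by move=> y _; rewrite lee_fin.
  - by rewrite lee_fin.
rewrite ge0_integralZr//.
- by rewrite !ge0_integral_distribution//; apply/measurable_EFinP.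
- by apply/measurable_EFinP.
- by move=> y _; rewrite lee_fin.
- by apply: integral_ge0 => y _; rewrite lee_fin.
Qed.

Section ville.
Context (R : realType) (d : measure_display) (Omega : measurableType d).
Context (P : probability Omega R) (X : nat -> {RV P >-> R}).

(** A family stable under intersection that generates the sigma-algebra of the
    first [n] variables. A function of these variables is one that is measurable
    for the sigma-algebra it generates, seen as another measurable structure on
    [Omega]. *)
Definition past_events (n : nat) : set_system Omega :=
  [set A | exists B : nat -> set R, (forall k, measurable (B k)) /\
     A = \bigcap_(k in [set` iota 0 n]) X k @^-1` B k].

Lemma past_events_measurable n : past_events n `<=` measurable.
Proof.
move=> A [B [mB ->]]; apply: fin_bigcap_measurable => // k _.
by rewrite -[_ @^-1` _]setTI; exact: measurable_funPT.
Qed.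

Lemma past_eventsI n : setI_closed (past_events n).
Proof.
move=> A A' [B [mB ->]] [B' [mB' ->]].
exists (fun k => B k `&` B' k); split; first by move=> k; exact: measurableI.
by rewrite -bigcapI.
Qed.

Lemma past_eventsT n : past_events n setT.
Proof.
exists (fun=> setT); split => //; apply/esym/seteqP; split => // w _ k _ //.
Qed.

Hypothesis indepX :
  independent_systems P (fun k => preimage_set_system setT (X k) measurable).

(** Both sides are finite measures in [A]; they agree on [past_events n] by
    the product rule, hence on the sigma-algebra it generates. *)
Lemma past_events_indep n A B : <<s past_events n >> A -> measurable B ->
  (P (A `&` X n @^-1` B) = P A * P (X n @^-1` B))%E.
Proof.
move=> sA mB.
have mXB : measurable (X n @^-1` B).
  by rewrite -[_ @^-1` _]setTI; exact: measurable_funPT.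
have P01 : (0 <= fine (P (X n @^-1` B)))%R by exact: fine_ge0.
have finP : (fine (P (X n @^-1` B)))%:E = P (X n @^-1` B).
  by rewrite fineK// fin_num_measure.
rewrite muleC -finP.
pose m1 := mrestr P mXB; pose m2 := mscale (NngNum P01) P.
have -> : P (A `&` X n @^-1` B) = m1 A by [].
rewrite -[RHS]/(m2 A).
apply: (@g_sigma_algebra_measure_unique _ _ _ (past_events n) _ (fun=> setT)) => //.
- exact: past_events_measurable.
- by move=> _; exact: past_eventsT.
- by apply/seteqP; split => // w _; exists 0%N.
- exact: past_eventsI.
- move=> {sA A} A [C [mC AE]].
  have mA : measurable A by apply: (@past_events_measurable n); exists C.
  rewrite /m1 /m2 /= /mrestr /mscale /= finP.
  pose E k := X k @^-1` (if (k < n)%N then C k else B).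
  have mE k : preimage_set_system setT (X k) measurable (E k).
    exists (if (k < n)%N then C k else B); last by rewrite setTI.
    by case: ifP.
  have EA : (\bigcap_(k in [set` iota 0 n]) E k) = A.
    rewrite AE; apply: eq_bigcapr => k; rewrite /mkset mem_iota add0n /= => kn.
    by rewrite /E kn.
  have EAB : (\bigcap_(k in [set` iota 0 n.+1]) E k) = A `&` X n @^-1` B.
    rewrite -EA; apply/seteqP; split => w.
    - move=> H; split.
      + move=> k; rewrite /mkset mem_iota => kn; apply: H.
        by rewrite /mkset mem_iota; lia.
      + have := H n; rewrite /E ltnn; apply.
        by rewrite /mkset mem_iota; lia.
    - move=> [H Hn] k; rewrite /mkset mem_iota add0n leq0n /= ltnS leq_eqVlt.
      move=> /orP[/eqP ->|kn]; first by rewrite /E ltnn.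
      by apply: H; rewrite /mkset mem_iota.
  rewrite -EAB (indepX (iota_uniq 0 n.+1) (fun k _ => mE k)) -addn1 iotaD add0n.
  rewrite big_cat /= big_seq1 -(indepX (iota_uniq 0 n) (fun k _ => mE k)) EA.
  by rewrite muleC /E ltnn.
- move=> k; rewrite /m1 /= /mrestr setTI.
  by rewrite ltey_eq fin_num_measure.
Qed.

Context (h : nat -> R -> R).
Hypothesis mh : forall k, measurable_fun setT (h k).
Hypothesis h0 : forall k x, 0 <= h k x.
Hypothesis h1 : forall k, (\int[P]_w (h k (X k w))%:E = 1)%E.

(** The product of the factors, frozen as soon as it reaches [b]. Freezing
    preserves the expectation, and turns the event that some partial product
    reaches [b] into an event on the last value, to which Markov's inequality
    applies. *)
Fixpoint stopped_product (b : R) (s : nat) (w : Omega) : R :=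
  if s is s'.+1 then
    let v := stopped_product b s' w in
    if b <= v then v else v * h s' (X s' w)
  else 1.

Lemma stopped_product_ge0 b s w : 0 <= stopped_product b s w.
Proof. by elim: s => //= s IH; case: ifP => // _; rewrite mulr_ge0. Qed.

Lemma stopped_product_crossed b N w :
  (exists2 s, (s <= N)%N & b <= \prod_(0 <= k < s) h k (X k w)) ->
  b <= stopped_product b N w.
Proof.
case=> s sN bs; have keep m : b <= stopped_product b m w ->
    b <= stopped_product b m.+1 w by move=> /= bv; rewrite {1}bv.
have run m : b <= stopped_product b m w \/
    stopped_product b m w = \prod_(0 <= k < m) h k (X k w).
  elim: m => [|m [IH|IH]]; first by right; rewrite big_nil.
  - by left; exact: keep.
  - rewrite /=; case: ifPn => [bm|_]; first by left.
    by right; rewrite big_nat_recr//= IH.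
have bs' : b <= stopped_product b s w by case: (run s) => [//|->].
rewrite -(subnKC sN); elim: (N - s)%N => [|m IH]; first by rewrite addn0.
by rewrite addnS; exact: keep.
Qed.

Lemma stopped_product_past b s n : (s <= n)%N ->
  measurable_fun (setT : set (g_sigma_algebraType (past_events n)))
    (stopped_product b s).
Proof.
elim: s => [|s IH] sn; first exact: measurable_cst.
have mX : measurable_fun (setT : set (g_sigma_algebraType (past_events n))) (X s).
  move=> _ B mB; rewrite setTI; apply: sub_sigma_algebra.
  exists (fun k => if k == s then B else setT); split.
    by move=> k; case: ifP.
  apply/seteqP; split => w /=.
  - by move=> Bw k _; case: eqP => [->|].
  - by move=> /(_ s); rewrite eqxx; apply; rewrite /= mem_iota; lia.
have mv := IH (ltnW sn).
apply: measurable_fun_ifT => //=.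
- exact: measurable_fun_ler.
- by apply: measurable_funM => //; exact: (measurableT_comp (mh s)).
Qed.

Lemma stopped_product_measurable b s : measurable_fun setT (stopped_product b s).
Proof.
move=> mT B mB; have := @stopped_product_past b s s (leqnn s) measurableT B mB.
by apply: smallest_sub; [exact: sigma_algebra_measurable|
  exact: past_events_measurable].
Qed.

(** Split according to whether the product is already frozen: the frozen part
    is unchanged, and the rest is multiplied by a factor of mean one that is
    independent of it. *)
Lemma expectation_stopped_product b s :
  (\int[P]_w (stopped_product b s w)%:E = 1)%E.
Proof.
elim: s => [|s IH] /=.
  by rewrite integral_cst// mul1e; exact: probability_setT.
pose F (v : R) := if b <= v then 0 else v.
pose F' (v : R) := if b <= v then v else 0.
have mF : measurable_fun setT F.
  apply: measurable_fun_ifT => //; exact: measurable_fun_ler.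
have mF' : measurable_fun setT F'.
  apply: measurable_fun_ifT => //; exact: measurable_fun_ler.
pose V := stopped_product b s.
have V0 w : 0 <= V w := stopped_product_ge0 b s w.
pose G (w : g_sigma_algebraType (past_events s)) := F (V w).
have FV0 w : 0 <= F (V w) by rewrite /F; case: ifP.
have F'V0 w : 0 <= F' (V w) by rewrite /F'; case: ifP.
have mV := stopped_product_measurable b s.
have -> : (fun w => (if b <= stopped_product b s w then stopped_product b s w
    else stopped_product b s w * h s (X s w))%:E) =
    (fun w => (F' (V w))%:E + (F (V w) * h s (X s w))%:E)%E.
  apply/funext => w; rewrite -EFinD /F /F' /V; case: ifP => _.
    by rewrite mul0r addr0.
  by rewrite add0r.
rewrite ge0_integralD//; last 4 first.
- by move=> w _; rewrite lee_fin.
- by apply/measurable_EFinP; exact: measurableT_comp mF' mV.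
- by move=> w _; rewrite lee_fin mulr_ge0.
- apply/measurable_EFinP; apply: measurable_funM.
    exact: measurableT_comp mF mV.
  by apply: measurableT_comp (mh s) _.
have -> : (\int[P]_w (F (V w) * h s (X s w))%:E =
    \int[P]_w (F (V w))%:E * \int[P]_w (h s (X s w))%:E)%E.
  have mid : measurable_fun setT
      (id : Omega -> g_sigma_algebraType (past_events s)).
    move=> _ B mB; rewrite setTI preimage_id.
    by apply: smallest_sub mB; [exact: sigma_algebra_measurable|
      exact: past_events_measurable].
  apply: (@ge0_expectation_indep _ _ _ _ _ P
    (g_sigma_algebraType (past_events s)) _ id (X s) G (h s) mid) => //.
  - by move=> A B mA mB; exact: past_events_indep.
  - by apply: measurableT_comp mF _; exact: stopped_product_past.
rewrite h1 mule1 -ge0_integralD//; last 4 first.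
- by move=> w _; rewrite lee_fin.
- by apply/measurable_EFinP; exact: measurableT_comp mF' mV.
- by move=> w _; rewrite lee_fin.
- by apply/measurable_EFinP; exact: measurableT_comp mF mV.
rewrite -IH; apply: eq_integral => w _.
by rewrite -EFinD /F /F' /V; case: ifP => _; rewrite ?addr0 ?add0r.
Qed.

Lemma product_crossing_measurable (b : R) N : measurable
  [set w : Omega | exists2 s, (s <= N)%N &
    (b <= \prod_(0 <= k < s) h k (X k w))%R].
Proof.
have -> : [set w : Omega | exists2 s, (s <= N)%N &
    (b <= \prod_(0 <= k < s) h k (X k w))%R]
    = \bigcup_(s in [set s | (s <= N)%N])
        [set w | (b <= \prod_(0 <= k < s) h k (X k w))%R].
  by apply/seteqP; split => w [s /= sN bs]; exists s.
apply: bigcup_measurable => s _.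
rewrite -[X in measurable X]setTI.
apply: measurable_fun_le => //; apply: measurable_prod => k _.
exact: measurableT_comp (mh k) _.
Qed.

(** Markov's inequality for [stopped_product b N]. *)
Lemma ville (b : R) N : 0 < b ->
  (P [set w : Omega | exists2 s, (s <= N)%N &
    (b <= \prod_(0 <= k < s) h k (X k w))%R]
   <= b^-1%:E)%E.
Proof.
move=> b0; rewrite -[leRHS]mul1e -(expectation_stopped_product b N).
rewrite lee_pdivlMr//; set A := [set w | _].
have mA : measurable A by exact: product_crossing_measurable.
have -> : (P A * b%:E = \int[P]_w (b * \1_A w)%:E)%E.
  under eq_integral do rewrite EFinM.
  rewrite ge0_integralZl//; last 2 first.
  - by apply/measurable_EFinP; exact: measurable_indic.
  - by rewrite lee_fin ltW.
  by rewrite integral_indic// setIT muleC.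
apply: ge0_le_integral => //.
- by move=> w _; rewrite lee_fin mulr_ge0// ltW.
- by apply/measurable_EFinP; apply: measurable_funM => //; exact: measurable_indic.
- by apply/measurable_EFinP; exact: stopped_product_measurable.
move=> w _; rewrite lee_fin indicE; case: (boolP (w \in A)) => [|_].
  by rewrite inE mulr1 => /stopped_product_crossed.
by rewrite mulr0; exact: stopped_product_ge0.
Qed.

End ville.

(** * Gaussian rewards: the line-crossing inequality *)

(** The Radon-Nikodym derivative is unique almost everywhere, so it is the
    density that defines the measure. *)
Lemma ge0_integral_normal_prob (R : realType) (m s : R) (f : R -> R) :
  measurable_fun setT f -> (forall x, 0 <= f x) ->
  (\int[normal_prob m s]_x (f x)%:E =
   \int[lebesgue_measure]_x (f x * normal_pdf m s x)%:E)%E.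
Proof.
move=> mf f0.
have dom := normal_prob_dominates m s.
rewrite -(Radon_Nikodym_SigmaFinite.change_of_variables dom)//; last first.
  by apply/measurable_EFinP.
have mpdf : measurable_fun setT (fun x => (normal_pdf m s x)%:E).
  by apply/measurable_EFinP; exact: measurable_normal_pdf.
have iRN := Radon_Nikodym_SigmaFinite.f_integrable dom.
have mRN := measurable_int _ iRN.
under [RHS]eq_integral do rewrite EFinM.
apply: ae_eq_integral => //.
- by apply: emeasurable_funM => //; exact/measurable_EFinP.
- by apply: emeasurable_funM => //; exact/measurable_EFinP.
apply: ae_eqe_mul2l; apply: integral_ae_eq => // E _ mE.
by rewrite -(Radon_Nikodym_SigmaFinite.f_integral dom).
Qed.

(** Completing the square turns the tilted density of mean [m] into the
    density of mean [m + lam]. *)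
Lemma normal_exponential_moment (R : realType) (m lam : R) :
  (\int[normal_prob m 1]_x (expR (lam * (x - m) - lam ^+ 2 / 2))%:E = 1)%E.
Proof.
have mf : measurable_fun setT (fun x : R => expR (lam * (x - m) - lam ^+ 2 / 2)).
  apply: measurableT_comp => //; apply: measurable_funB => //.
  by apply: measurable_funM => //; exact: measurable_funB.
rewrite ge0_integral_normal_prob//.
rewrite -[RHS](integral_normal_pdf (m + lam) 1); apply: eq_integral => x _.
congr EFin; rewrite !normal_pdfE ?oner_neq0// /normal_fun mulrCA -expRD.
congr (_ * expR _); rewrite expr1n; by field.
Qed.

(** [normal_prob] lives on the Borel structure generated by half-open
    intervals, whose display differs from that of [R]; the random variable has to
    be read into that structure before the two measures can be compared. *)
Lemma ge0_expectation_normal (R : realType) (d : measure_display)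
    (Omega : measurableType d) (P : probability Omega R) (X : {RV P >-> R})
    (m s : R) (f : R -> R) :
  (forall B : set R, measurable B -> distribution P X B = normal_prob m s B) ->
  measurable_fun setT f -> (forall x, 0 <= f x) ->
  (\int[P]_w (f (X w))%:E = \int[normal_prob m s]_y (f y)%:E)%E.
Proof.
move=> lawX mf f0.
have mX : measurable_fun setT (X : Omega -> measurableTypeR R).
  by move=> mT B mB; exact: (@measurable_funPT _ _ _ _ X).
have mf' : measurable_fun (setT : set (measurableTypeR R)) (fun x => (f x)%:E).
  exact/measurable_EFinP.
pose X' : {mfun Omega >-> measurableTypeR R} :=
  HB.pack (X : Omega -> measurableTypeR R) (isMeasurableFun.Build _ _ _ _ _ mX).
rewrite -[LHS](@ge0_integral_distribution _ _ _ (measurableTypeR R) _ P X'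
  (fun x => (f x)%:E))//.
apply: (@eq_measure_integral _ (measurableTypeR R) R setT (normal_prob m s)) => A mA _.
exact: lawX.
Qed.

(** [ville] applied to the factors [exp (lam * (x - mu i) - lam ^ 2 / 2)]. The
    parameter [lam] may be negative, which bounds the sums from below. *)
Lemma line_crossing (R : realType) (d : measure_display)
    (Omega : measurableType d) (P : probability Omega R) (d' : measure_display)
    (V : measurableType d') (mu : 'I_2 -> R) (X : 'I_2 -> nat -> {RV P >-> R})
    (U : {mfun Omega >-> V}) (i : 'I_2) (lam c : R) (N : nat) :
  gaussian_bandit mu X U ->
  (P [set w | exists2 s, (s <= N)%N &
      c <= lam * (\sum_(0 <= k < s) (X i k w - mu i)) - s%:R * (lam ^+ 2 / 2)]%R
   <= (expR (- c))%:E)%E.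
Proof.
move=> [lawX indepX].
pose h (k : nat) (x : R) := expR (lam * (x - mu i) - lam ^+ 2 / 2).
have mh k : measurable_fun setT (h k).
  apply: measurableT_comp => //; apply: measurable_funB => //.
  by apply: measurable_funM => //; exact: measurable_funB.
have h1 k : (\int[P]_w (h k (X i k w))%:E = 1)%E.
  rewrite -(normal_exponential_moment (mu i) lam).
  apply: ge0_expectation_normal => //; first exact: lawX.
  by move=> x; exact: expR_ge0.
have indepXi : independent_systems P
    (fun k => preimage_set_system setT (X i k) measurable).
  move=> s E us sE.
  pose f (k : nat) := Some (i, k).
  pose E' (o : option ('I_2 * nat)) := if o is Some (j, k) then E k else setT.
  have inj_f : injective f by move=> a b [].
  have := @indepX (map f s) E'; rewrite map_inj_uniq// => /(_ us).
  rewrite big_map /=; have -> : \bigcap_(o in [set` map f s]) E' o =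
      \bigcap_(k in [set` s]) E k.
    apply/seteqP; split => w H.
    - by move=> k ks; apply: (H (f k)); exact: map_f.
    - by move=> o /mapP[k ks ->]; exact: H.
  by apply=> _ /mapP[k ks ->]; exact: sE.
have h0 k x : 0 <= h k x by exact: expR_ge0.
rewrite expRN.
have -> : [set w | exists2 s, (s <= N)%N & c <= lam *
      (\sum_(0 <= k < s) (X i k w - mu i)) - s%:R * (lam ^+ 2 / 2)]%R =
    [set w | exists2 s, (s <= N)%N &
      expR c <= \prod_(0 <= k < s) h k (X i k w)]%R.
  have prodE s w : \prod_(0 <= k < s) h k (X i k w) =
      expR (lam * (\sum_(0 <= k < s) (X i k w - mu i)) - s%:R * (lam ^+ 2 / 2)).
    by rewrite /h -expR_sum sumrB -mulr_sumr sumr_const_nat subn0 mulr_natl.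
  by apply/seteqP; split => w [s sN H]; exists s => //; move: H;
    rewrite prodE ler_expR.
exact: (ville indepXi mh h0 h1 N (expR_gt0 c)).
Qed.

(** * Trajectories, measurability, and the regret as a number of draws *)

Lemma other_arm (b o a : 'I_2) : b != o -> (a == b) = (a != o).
Proof. by case: a b o => [[|[|]]] // ? [[|[|]]] // ? [[|[|]]]. Qed.

Lemma two_arms (b o : 'I_2) : b != o -> (b = 0 /\ o = 1) \/ (b = 1 /\ o = 0).
Proof.
by case: b o => [[|[|]]] // ? [[|[|]]] // ? _; [left|right]; split; exact: val_inj.
Qed.

Section play.
Context (V : Type) (R : realType) (p : strategy V R) (u : V) (x : 'I_2 -> nat -> R).
Local Notation h t := (play p u x t).

Lemma size_play t : size (h t) = t.
Proof. by elim: t => //= t IH; rewrite size_rcons IH. Qed.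

Lemma drawsS t i : draws (h t.+1) i = (draws (h t) i + (p u (h t) == i))%N.
Proof. by rewrite /draws /= -cats1 count_cat /= addn0. Qed.

Lemma drawsE t i : draws (h t) i = (\sum_(s < t) (p u (h s) == i))%N.
Proof.
elim: t => [|t IH]; first by rewrite big_ord0.
by rewrite drawsS big_ord_recr /= IH.
Qed.

Lemma draws_le t i : (draws (h t) i <= t)%N.
Proof. by rewrite -[leqRHS]size_play; exact: count_size. Qed.

Lemma draws_mono s t i : (s <= t)%N -> (draws (h s) i <= draws (h t) i)%N.
Proof.
move=> /subnKC <-; elim: (t - s)%N => [|m IH]; first by rewrite addn0.
by rewrite addnS drawsS (leq_trans IH)// leq_addr.
Qed.

Lemma draws_two t (b o : 'I_2) : b != o -> (draws (h t) b + draws (h t) o = t)%N.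
Proof.
move=> bo; elim: t => [|t IH] //; rewrite !drawsS (other_arm _ bo).
by case: (_ == o) => /=; lia.
Qed.

Lemma rewards_play t i :
  \sum_(az <- h t | az.1 == i) az.2 = \sum_(0 <= k < draws (h t) i) x i k.
Proof.
elim: t => [|t IH]; first by rewrite big_nil big_nil.
rewrite drawsS /= -cats1 big_cat /= IH big_cons big_nil /=.
case: eqP => [->|_]; last by rewrite addn0 addr0.
by rewrite addn1 big_nat_recr//= addr0.
Qed.

Lemma nth_play t j z : (j < t)%N -> nth z (h t) j =
  (p u (h j), x (p u (h j)) (draws (h j) (p u (h j)))).
Proof.
elim: t => // t IH; rewrite ltnS leq_eqVlt => /orP[/eqP->|jt] /=.
  by rewrite nth_rcons size_play ltnn eqxx.
by rewrite nth_rcons size_play jt IH.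
Qed.

Lemma take_play t j : (j <= t)%N -> take j (h t) = h j.
Proof.
move=> /subnKC <-; elim: (t - j)%N => [|m IH].
  by rewrite addn0 -{1}(size_play j) take_size.
by rewrite addnS /= -cats1 takel_cat ?IH// size_play leq_addr.
Qed.

End play.

(** The index of an arm as a function of its number of draws: [ucb_star_index]
    along any trajectory, by [ucb_star_index_play]. *)
Definition stack_index (R : realType) (T : nat) (x : nat -> R) (s : nat) : R :=
  (\sum_(0 <= k < s) x k) / s%:R + Num.sqrt (2 / s%:R * ln (T%:R / s%:R)).

Lemma ucb_star_index_play (V : Type) (R : realType) (p : strategy V R) (u : V)
    (x : 'I_2 -> nat -> R) (T t : nat) (i : 'I_2) :
  ucb_star_index T (play p u x t) i =
  if draws (play p u x t) i == 0%N then +oo%E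
  else (stack_index T (x i) (draws (play p u x t) i))%:E.
Proof.
by rewrite /ucb_star_index /empirical_mean /stack_index rewards_play.
Qed.

Section measurability.
Context (R : realType) (d : measure_display) (Omega : measurableType d).
Context (P : probability Omega R) (d' : measure_display) (V : measurableType d').
Context (X : 'I_2 -> nat -> {RV P >-> R}) (U : {mfun Omega >-> V}).
Context (p : strategy V R) (mp : measurable_strategy p).
Local Notation h t w := (play p (U w) (fun i s => X i s w) t).

(** Once the sequence of arms is fixed, the position in the stacks of each
    reward is fixed as well, so the rewards are a measurable function of [w].
    Partitioning according to the finitely many sequences of arms then makes the
    actions measurable. *)
Definition rewards_along t (a : t.-tuple 'I_2) (w : Omega) : t.-tuple R :=
  [tuple X (tnth a j) (count_mem (tnth a j) (take j a)) w | j < t].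

Lemma play_along t (a : t.-tuple 'I_2) w :
  unzip1 (h t w) = a -> h t w = zip a (rewards_along a w).
Proof.
move=> ha; have sa : size a = t by rewrite size_tuple.
apply: (@eq_from_nth _ (ord0, 0)).
  by rewrite size_play size_zip !size_tuple minnn.
move=> j; rewrite size_play => jt.
rewrite nth_zip ?size_tuple// nth_play//.
have -> : p (U w) (h j w) = nth ord0 a j.
  by rewrite -ha (nth_map (ord0, 0)) ?size_play// nth_play.
have -> : nth 0 (rewards_along a w) j =
    X (nth ord0 a j) (count_mem (nth ord0 a j) (take j a)) w.
  pose jo := Ordinal jt; rewrite -[j]/(val jo) -tnth_nth tnth_mktuple /=.
  by rewrite (tnth_nth ord0).
congr (_, X _ _ w); rewrite -ha -map_take take_play ?(ltnW jt)//.
by rewrite /draws count_map.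
Qed.

Lemma measurable_rewards_along t (a : t.-tuple 'I_2) :
  measurable_fun setT (rewards_along a).
Proof.
apply/measurable_fun_tnthP => j.
have -> : (@tnth t R)^~ j \o rewards_along a =
    X (tnth a j) (count_mem (tnth a j) (take j a)).
  by apply/funext => w /=; rewrite tnth_mktuple.
exact: measurable_funPT.
Qed.

Lemma measurable_action_along t (a : t.-tuple 'I_2) i :
  measurable [set w | p (U w) (zip a (rewards_along a w)) = i].
Proof.
have mf : measurable_fun setT (fun w => (U w, rewards_along a w)).
  by apply: measurable_fun_pair => //; exact: measurable_rewards_along.
by have := mf measurableT _ (mp a i); rewrite setTI.
Qed.

Lemma measurable_arms t (a : seq 'I_2) :
  measurable [set w | unzip1 (h t w) = a].
Proof.
elim: t a => [|t IH] a.
  case: a => [|i a].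
    by have -> : [set w | unzip1 (h 0 w) = [::]] = setT by apply/seteqP; split.
  by have -> : [set w | unzip1 (h 0 w) = i :: a] = set0 by apply/seteqP; split.
case/lastP: a => [|a i].
  have -> : [set w | unzip1 (h t.+1 w) = [::]] = set0; last by [].
  apply/seteqP; split => // w /= /(congr1 size).
  by rewrite size_map size_rcons.
have [/eqP sa|sa] := boolP (size a == t); last first.
  have -> : [set w | unzip1 (h t.+1 w) = rcons a i] = set0; last by [].
  apply/seteqP; split => // w /= /(congr1 size) /eqP.
  by rewrite size_map !size_rcons size_play eqSS eq_sym (negbTE sa).
pose ta : t.-tuple 'I_2 := Tuple (introT eqP sa).
have -> : [set w | unzip1 (h t.+1 w) = rcons a i] =
    [set w | unzip1 (h t w) = a] `&`
    [set w | p (U w) (zip ta (rewards_along ta w)) = i].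
  apply/seteqP; split => w; rewrite /= /unzip1 map_rcons.
  - move=> /rcons_inj [aE <-]; split=> //.
    by rewrite -(play_along (a := ta) aE).
  - by move=> [aE <-]; rewrite -(play_along (a := ta) aE) aE.
by apply: measurableI => //; exact: measurable_action_along.
Qed.

Lemma measurable_action t i : measurable [set w | action X U p t w = i].
Proof.
have -> : [set w | action X U p t w = i] =
    \bigcup_(a in [set: t.-tuple 'I_2]) ([set w | unzip1 (h t w) = a] `&`
    [set w | p (U w) (zip a (rewards_along a w)) = i]).
  apply/seteqP; split => w /=.
  - move=> wi; have sa : size (unzip1 (h t w)) == t by rewrite size_map size_play.
    exists (Tuple sa) => //=; split => //.
    by rewrite -(play_along (a := Tuple sa)).
  - by move=> [a _ [/= aE <-]]; rewrite /action (play_along aE).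
apply: fin_bigcup_measurable => // a _; apply: measurableI.
  exact: measurable_arms.
exact: measurable_action_along.
Qed.

Lemma measurable_draws t i :
  measurable_fun setT (fun w => (draws (h t w) i)%:R : R).
Proof.
have -> : (fun w => (draws (h t w) i)%:R : R) =
    (fun w => \sum_(s < t) \1_[set w | action X U p s w = i] w).
  apply/funext => w; rewrite drawsE natr_sum; apply: eq_bigr => s _.
  rewrite indicE; congr (_ %:R); congr nat_of_bool.
  by apply/eqP/idP; rewrite inE.
apply: measurable_sum => s; apply: measurable_indic; exact: measurable_action.
Qed.

Lemma expected_draws_le t i :
  (0 <= \int[P]_w (draws (h t w) i)%:R%:E <= t%:R%:E)%E.
Proof.
rewrite integral_ge0 /=; last by move=> w _; rewrite lee_fin.
have -> : t%:R%:E = (\int[P]_w t%:R%:E)%E :> \bar R.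
  rewrite integral_cst// -[LHS]mule1; congr (_ * _)%E; exact/esym/probability_setT.
apply: ge0_le_integral => //.
- by apply/measurable_EFinP; exact: measurable_draws.
- by move=> w _; rewrite lee_fin ler_nat draws_le.
Qed.

(** Each round earns [mu b], minus the gap if [o] is drawn. *)
Lemma regretE (mu : 'I_2 -> R) T (b o : 'I_2) : b != o -> mu o <= mu b ->
  regret mu X U p T =
  (mu b - mu o) * fine (\int[P]_w (draws (h T w) o)%:R%:E)%E.
Proof.
move=> bo mub; set N := (\int[P]_w (draws (h T w) o)%:R%:E)%E.
have finN : N \is a fin_num.
  have /andP[N0 NT] := expected_draws_le T o.
  by rewrite ge0_fin_numE// (le_lt_trans NT)// ltry.
rewrite /regret.
have -> : Num.max (mu 0) (mu 1) = mu b.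
  have -> : Num.max (mu 0) (mu 1) = Num.max (mu b) (mu o).
    by have [[-> ->]|[-> ->]] := two_arms bo; rewrite // maxC.
  exact: max_idPl.
have -> : ('E_P[fun w => (\sum_(t < T) mu (action X U p t w))%R] =
    (T%:R * mu b)%:E - (mu b - mu o)%:E * N)%E.
  rewrite unlock.
  have -> : (fun w => (\sum_(t < T) mu (action X U p t w))%:E) =
     (fun w => (T%:R * mu b)%:E -
       (mu b - mu o)%:E * (draws (h T w) o)%:R%:E)%E.
    apply/funext => w; rewrite -EFinM -EFinB; congr EFin.
    rewrite drawsE natr_sum mulr_sumr mulr_natl -[X in _ *+ X](card_ord T).
    rewrite -sumr_const -sumrB; apply: eq_bigr => t _; rewrite /action.
    case: eqP => [->|]; first by rewrite mulr1 opprB addrC subrK.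
    by rewrite mulr0 subr0 => /eqP; rewrite -(other_arm _ bo) => /eqP ->.
  have iN : P.-integrable setT
      (fun w => (mu b - mu o)%:E * (draws (h T w) o)%:R%:E)%E.
    apply: integrableZl => //; apply/integrableP; split.
      by apply/measurable_EFinP; exact: measurable_draws.
    under eq_integral do rewrite gee0_abs ?lee_fin//.
    by rewrite -/N -ge0_fin_numE//; have /andP[] := expected_draws_le T o.
  rewrite integralB//; last first.
    by apply: finite_measure_integrable_cst.
  rewrite integral_cst// (_ : _ setT = 1%E); last exact: probability_setT.
  rewrite mule1 ge0_integralZl//.
  - by apply/measurable_EFinP; exact: measurable_draws.
  - by rewrite lee_fin subr_ge0.
rewrite -(fineK finN) -EFinM -EFinB /=; ring.
Qed.

End measurability.

(** * From index events to the expected number of draws *)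

(** The arm [o] passes from [s] to [s + 1] draws in a round where its index is
    at least that of [b], hence at least [m]. The first draw of [o] is due to its
    infinite initial index, so it says nothing about the stack: hence the
    condition [0 < s]. *)
Lemma draws_indices (V : Type) (R : realType) (p : strategy V R) (u : V)
    (x : 'I_2 -> nat -> R) (T : nat) (b o : 'I_2) (m : R) (t : nat) :
  (forall h : history R, (size h < T)%N ->
     forall i, (ucb_star_index T h i <= ucb_star_index T h (p u h))%E) ->
  (forall s, (0 < s < T)%N -> m <= stack_index T (x b) s) ->
  (t <= T)%N -> forall s, (0 < s < draws (play p u x t) o)%N ->
  m <= stack_index T (x o) s.
Proof.
move=> hp hb; elim: t => [|t IH] tT s; first by rewrite ltn0 andbF.
rewrite drawsS; case: eqP => [po|_]; last by rewrite addn0; apply: IH; exact: ltnW.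
rewrite addn1 ltnS => /andP[s0]; rewrite leq_eqVlt => /orP[/eqP sE|sN]; last first.
  by apply: IH; [exact: ltnW|rewrite s0].
have := hp (play p u x t) _ b; rewrite size_play => /(_ tT).
rewrite po !ucb_star_index_play -sE (gtn_eqF s0).
case: ifPn => [|Nb0]; first by rewrite leye_eq.
rewrite lee_fin; apply: le_trans; apply: hb.
by rewrite lt0n Nb0/= (leq_ltn_trans (draws_le _ _ _ _ _)).
Qed.

(** Every [s] below the final number of draws satisfies [draws_indices], or is
    zero: counting them bounds that number. *)
Lemma draws_decomposition (V : Type) (R : realType) (p : strategy V R) (u : V)
    (x : 'I_2 -> nat -> R) (T : nat) (b o : 'I_2) (m : R) :
  (forall h : history R, (size h < T)%N ->
     forall i, (ucb_star_index T h i <= ucb_star_index T h (p u h))%E) ->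
  (forall s, (0 < s < T)%N -> m <= stack_index T (x b) s) ->
  (draws (play p u x T) o <=
   1 + \sum_(1 <= s < T) (m <= stack_index T (x o) s)%R)%N.
Proof.
move=> hp hb; have := draws_indices hp hb (leqnn T) (o := o).
have := draws_le p u x T o; set N := draws _ _ => NT ind.
case: (posnP N) => [->//|N0].
rewrite (big_cat_nat (n := N))//= addnA.
apply: leq_trans (leq_addr _ _).
rewrite (eq_big_nat _ _ (F2 := fun=> 1%N)); last by move=> s sN; rewrite ind.
by rewrite sum_nat_const_nat muln1; lia.
Qed.

Section expected_draws.
Context (R : realType) (d : measure_display) (Omega : measurableType d).
Context (P : probability Omega R) (d' : measure_display) (V : measurableType d').
Context (X : 'I_2 -> nat -> {RV P >-> R}) (U : {mfun Omega >-> V}).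

Lemma measurable_stack_index T i s :
  measurable_fun setT (fun w => stack_index T ((X i)^~ w) s : R).
Proof.
apply: measurable_funD => //; apply: measurable_funM => //.
by apply: measurable_sum => k; exact: measurable_funPT.
Qed.

(** On the event that the index of [b] falls below [m], the trivial bound [T]
    on the number of draws is used. *)
Lemma expected_draws_upper T (p : strategy V R) (b o : 'I_2) (m q : R)
    (f : nat -> R) :
  ucb_star T p ->
  (P [set w | exists2 s, (0 < s < T)%N & stack_index T ((X b)^~ w) s < m]%R
    <= q%:E)%E ->
  (forall s, (0 < s < T)%N ->
    (P [set w | m <= stack_index T ((X o)^~ w) s]%R <= (f s)%:E)%E) ->
  fine (\int[P]_w (draws (play p (U w) (fun i s => X i s w) T) o)%:R%:E)%E <=
  T%:R * q + 1 + \sum_(1 <= s < T) f s.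
Proof.
move=> [mp hp]; set B := [set w | exists2 s, _ & _] => hq hf.
pose I s := [set w | m <= stack_index T ((X o)^~ w) s].
have mI s : measurable (I s).
  rewrite -[X in measurable X]setTI; apply: measurable_fun_le => //.
  exact: measurable_stack_index.
have mB : measurable B.
  have -> : B = \bigcup_(s in [set s | (0 < s < T)%N])
      [set w | stack_index T ((X b)^~ w) s < m].
    by apply/seteqP; split => w [s /= sN bs]; exists s.
  apply: bigcup_measurable => s _.
  have -> : [set w | stack_index T ((X b)^~ w) s < m] =
      ~` [set w | m <= stack_index T ((X b)^~ w) s].
    by apply/seteqP; split => w /=; rewrite real_ltNge ?num_real// => /negP.
  apply: measurableC; rewrite -[X in measurable X]setTI.
  by apply: measurable_fun_le => //; exact: measurable_stack_index.
pose S w : R := \sum_(1 <= s < T) \1_(I s) w.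
have S0 w : 0 <= S w by exact: sumr_ge0.
have pointwise w : (draws (play p (U w) (fun i s => X i s w) T) o)%:R <=
    T%:R * \1_B w + (1 + S w).
  rewrite indicE; case: (boolP (w \in B)) => [_|].
    by rewrite mulr1 ler_wpDr ?ler_nat ?draws_le// addr_ge0.
  rewrite notin_setE => wB; rewrite mulr0 add0r /S.
  under eq_bigr do rewrite indicE.
  rewrite -natr_sum -[1]/(1%:R) -natrD ler_nat.
  have good s : (0 < s < T)%N -> m <= stack_index T ((X b)^~ w) s.
    by move=> sT; rewrite leNgt; apply/negP => ?; apply: wB; exists s.
  have := draws_decomposition (x := fun i s => X i s w) o (hp (U w)) good.
  move/leq_trans; apply; rewrite leq_add2l; apply: leq_sum => s _.
  by rewrite leq_eqVlt; apply/orP; left; apply/eqP; congr nat_of_bool;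
    apply/idP/idP; rewrite inE.
have mind (A : set Omega) : measurable A ->
    measurable_fun setT (fun w => (\1_A w)%:E : \bar R).
  by move=> mA; apply/measurable_EFinP; exact: measurable_indic.
have mS : measurable_fun setT S.
  by apply: measurable_sum => s; exact: measurable_indic.
have mTB : measurable_fun setT (fun w => T%:R * \1_B w : R).
  by apply: measurable_funM => //; exact: measurable_indic.
have intS : (\int[P]_w (S w)%:E = \sum_(1 <= s < T) P (I s))%E.
  rewrite /S; under eq_integral do rewrite -sumEFin.
  rewrite ge0_integral_sum//; last by move=> s; exact: mind.
  by apply: eq_bigr => s _; rewrite integral_indic// setIT.
have bound : (\int[P]_w (draws (play p (U w) (fun i s => X i s w) T) o)%:R%:E <=
    (T%:R * q + 1 + \sum_(1 <= s < T) f s)%:E)%E.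
  apply: (@le_trans _ _ (\int[P]_w
    ((T%:R * \1_B w)%:E + (1 + (S w)%:E)))%E).
    apply: ge0_le_integral => //.
    - by apply/measurable_EFinP; exact: measurable_draws.
    - by apply: emeasurable_funD; [|apply: emeasurable_funD => //];
        exact/measurable_EFinP.
    - by move=> w _; rewrite -!EFinD lee_fin.
  have eTB : measurable_fun setT (fun w => (T%:R * \1_B w)%:E : \bar R).
    exact/measurable_EFinP.
  have eS : measurable_fun setT (fun w => (S w)%:E) by exact/measurable_EFinP.
  have e1S : measurable_fun setT (fun w => 1 + (S w)%:E)%E.
    exact: emeasurable_funD.
  have S0' w : [set: Omega] w -> (0 <= (S w)%:E)%E by rewrite lee_fin.
  have S1 w : [set: Omega] w -> (0 <= 1 + (S w)%:E)%E by rewrite adde_ge0// S0'.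
  rewrite ge0_integralD//.
  have -> : (T%:R * q + 1 + \sum_(1 <= s < T) f s)%:E =
      ((T%:R * q)%:E + (1 + (\sum_(1 <= s < T) f s)%:E))%E.
    by rewrite -addrA !EFinD.
  apply: leeD.
    under eq_integral do rewrite EFinM.
    rewrite ge0_integralZl//; last exact: mind.
    by rewrite integral_indic// setIT EFinM lee_pmul.
  rewrite ge0_integralD//; apply: leeD.
    by rewrite integral_cst// mul1e (_ : _ setT = 1%E)//; exact: probability_setT.
  rewrite intS -sumEFin big_nat [leRHS]big_nat; apply: lee_sum => s sT.
  exact: hf.
rewrite -lee_fin fineK// ge0_fin_numE.
  by rewrite (le_lt_trans bound)// ltry.
by apply: integral_ge0 => w _; rewrite lee_fin.
Qed.

End expected_draws.

(** * Covering the boundary of the best arm by lines *)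

Section grid.
Context (R : realType).
Implicit Types (eps T n s c r rho y : R).

(** On the cell from [n / r ^ 2] to [n * r ^ 2], the line with slope
    [lam / 2] and intercept [c / lam] lies below the boundary
    [eps * s + sqrt (2 * s * ln (T / s))]. The line of parameters [lam, c0] that
    touches the curve [sqrt (2 * c0 * s)] at [s = n] exceeds it at [n * q] by
    the factor [(1 + q) / (2 * sqrt q)], whose square is at most
    [1 / (1 - rho ^ 2)] for [q] between [1 / r ^ 2] and [r ^ 2]. This accounts
    for the factor [1 - rho ^ 2] in [c]; the rest of [c] is a lower bound, on
    the cell, for half the square of the boundary divided by [s]. *)
Lemma line_below_boundary eps T n s rho c (W : R) :
  0 < eps -> 0 < T -> 0 < n -> 0 < s -> 0 < rho < 1 -> s <= T ->
  let r := 1 + rho in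
  n <= s * r ^+ 2 -> s <= n * r ^+ 2 ->
  c = (1 - rho ^+ 2) * (eps ^+ 2 * n / (2 * r ^+ 2) + ln (T / (n * r ^+ 2))) ->
  0 < c ->
  eps * s + Num.sqrt (2 * s * ln (T / s)) <= W ->
  c <= Num.sqrt (2 * c / n) * W - s * (Num.sqrt (2 * c / n) ^+ 2 / 2).
Proof.
move=> eps0 T0 n0 s0 /andP[rho0 rho1] sT r ns sn cE c0 bW.
set lam := Num.sqrt (2 * c / n).
have r0 : 0 < r by rewrite /r; lra.
set l := ln (T / s) in bW.
have l0 : 0 <= l by apply: ln_ge0; rewrite ler_pdivlMr// mul1r.
have lam0 : 0 <= lam by exact: sqrtr_ge0.
have lam2 : lam ^+ 2 = 2 * c / n by rewrite sqr_sqrtr// divr_ge0//; lra.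
have ll : ln (T / (n * r ^+ 2)) <= l.
  rewrite ler_ln ?posrE ?divr_gt0// ?mulr_gt0 ?exprn_gt0//.
  by rewrite ler_pM2l// lef_pV2 ?posrE ?mulr_gt0 ?exprn_gt0.
set b := eps * s + Num.sqrt (2 * s * l) in bW.
have b0 : 0 <= b by rewrite addr_ge0 ?sqrtr_ge0// mulr_ge0// ltW.
have b2 : s * (eps ^+ 2 * s + 2 * l) <= b ^+ 2.
  have := sqr_sqrtr (_ : 0 <= 2 * s * l); rewrite /b.
  have := sqrtr_ge0 (2 * s * l); set v := Num.sqrt _.
  move=> v0 v2; rewrite sqrrD v2; last by rewrite !mulr_ge0// ltW.
  have : 0 <= eps * s * v by rewrite !mulr_ge0// ltW.
  rewrite -mulr_natr; nra.
have main : c * (n + s) <= n * (lam * b); last first.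
  rewrite -(ler_pM2l n0) mulrBr; have := ler_wpM2l lam0 bW.
  move=> /(ler_wpM2l (ltW n0)); rewrite lam2.
  have -> : n * (s * (2 * c / n / 2)) = c * s by field; lra.
  nra.
rewrite -(@ler_pXn2r _ 2)// ?nnegrE; first last.
- by rewrite mulr_ge0// ?mulr_ge0// ltW.
- by rewrite mulr_ge0//; lra.
have -> : (n * (lam * b)) ^+ 2 = n * (2 * c * b ^+ 2).
  by rewrite !exprMn lam2; field; lra.
have q : (1 - rho ^+ 2) * (n + s) ^+ 2 <= 4 * (n * s).
  have h1 : s - n <= rho * (n + s).
    have : s * (1 - rho) <= n * (1 + rho); last by lra.
    have : n * r ^+ 2 * (1 - rho) <= n * (1 + rho).
      rewrite -mulrA ler_pM2l// /r; nra.
    by apply: le_trans; rewrite ler_wpM2r//; lra.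
  have h2 : n - s <= rho * (n + s).
    have : n * (1 - rho) <= s * (1 + rho); last by lra.
    have : s * r ^+ 2 * (1 - rho) <= s * (1 + rho).
      rewrite -mulrA ler_pM2l// /r; nra.
    by apply: le_trans; rewrite ler_wpM2r//; lra.
  nra.
have e2 : 2 * c <= (1 - rho ^+ 2) * (eps ^+ 2 * s + 2 * l).
  have en : eps ^+ 2 * n / r ^+ 2 <= eps ^+ 2 * s.
    by rewrite -mulrA ler_wpM2l ?sqr_ge0// ler_pdivrMr ?exprn_gt0.
  have -> : 2 * c = (1 - rho ^+ 2) *
      (eps ^+ 2 * n / r ^+ 2 + 2 * ln (T / (n * r ^+ 2))).
    by rewrite cE; field; lra.
  by rewrite ler_wpM2l//; [nra|lra].
have d0 : 0 < 1 - rho ^+ 2 by nra.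
have step : c * (n + s) ^+ 2 <= 2 * (n * b ^+ 2).
  rewrite -(ler_pM2l d0).
  have : c * ((1 - rho ^+ 2) * (n + s) ^+ 2) <= c * (4 * (n * s)).
    by rewrite ler_wpM2l// ltW.
  have : 2 * c * (2 * n * s) <= (1 - rho ^+ 2) * (eps ^+ 2 * s + 2 * l) * (2 * n * s).
    by rewrite ler_wpM2r// !mulr_ge0// ltW.
  have : (1 - rho ^+ 2) * (2 * n) * (s * (eps ^+ 2 * s + 2 * l)) <=
      (1 - rho ^+ 2) * (2 * n) * b ^+ 2.
    by rewrite ler_wpM2l// mulr_ge0 ?(ltW d0)// mulr_ge0// ltW.
  nra.
rewrite exprMn; have := ler_wpM2l (ltW c0) step; nra.
Qed.

(** With [y ^ 2 = eps ^ 2 * n * r ^ 2] and [k = r ^ 4], the weight [h] is, up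
    to a constant factor, the bound on the probability of a cell multiplied by
    [T * eps ^ 2]. It is essentially
    [y ^ 2 * exp (- y ^ 2 / (2 * k))]; losing the power [1 - d] still leaves a
    bound of order [y] for small [y] and [1 / y] for large [y], which is what a
    geometric sum needs. *)
Lemma grid_weight_bound y (d k : R) : 0 < y -> 0 <= d <= 1 / 8 -> 1 <= k <= 4 ->
  let h := expR ((1 - d) * (ln (y ^+ 2) - y ^+ 2 / (2 * k))) in
  h <= 2 * y /\ h * y <= 32.
Proof.
move=> y0 /andP[d0 d8] /andP[k1 k4] h.
have lnE : ln (y ^+ 2) = 2 * ln y by rewrite lnXn// mulr_natl.
have k0 : 0 < k by lra.
case: (lerP y 1) => y1.
  have hy : h <= y.
    rewrite -[leRHS]lnK ?posrE// ler_expR lnE.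
    have ly : ln y <= 0 by exact: ln_le0.
    have : 0 <= y ^+ 2 / (2 * k) by rewrite divr_ge0 ?sqr_ge0//; lra.
    nra.
  have h0 : 0 <= h by exact: expR_ge0.
  by split; nra.
have hle : h <= y ^+ 2 * expR (- (y ^+ 2 / 10)).
  rewrite -[X in X * _]lnK ?posrE ?exprn_gt0// -expRD ler_expR lnE.
  have ly : 0 <= ln y by apply: ln_ge0; exact: ltW.
  have : y ^+ 2 / 8 <= y ^+ 2 / (2 * k).
    by rewrite ler_wpM2l ?sqr_ge0// lef_pV2 ?posrE; lra.
  have := sqr_ge0 y; set v := y ^+ 2 / (2 * k); nra.
have := expRxMexpNx_1 (y ^+ 2 / 10); set a := expR (y ^+ 2 / 10).
set a' := expR (- _) in hle *; move=> aa'.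
have a'0 : 0 < a' by exact: expR_gt0.
(* The polynomial [32 * (1 + y ^ 2 / 20) ^ 2 - y ^ 3] has no positive root, so
   this quadratic minorant of the exponential is enough. *)
have a1 : (1 + y ^+ 2 / 20) ^+ 2 <= a.
  have := expR_ge1Dx (y ^+ 2 / 20); rewrite /a.
  have -> : y ^+ 2 / 10 = y ^+ 2 / 20 + y ^+ 2 / 20 by field.
  rewrite expRD; set e' := expR _ => e1.
  have := sqr_ge0 y; nra.
split; apply: le_trans (_ : _ <= _) _.
- exact: hle.
- have : y <= 2 * a by have := sqr_ge0 (y - 5); nra.
  by move=> /(ler_wpM2l (ltW (mulr_gt0 y0 a'0))); nra.
- exact: (ler_wpM2r (ltW y0) hle).
- have : y ^+ 3 <= 32 * a.
    have : y ^+ 3 <= 32 * (1 + y ^+ 2 / 20) ^+ 2; last by lra.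
    have -> : 32 * (1 + y ^+ 2 / 20) ^+ 2 =
        y ^+ 3 + (2 / 25 * y ^+ 2 * ((y - 25 / 4) ^+ 2 + 15 / 16) + 32) by field.
    have := sqr_ge0 y; have := sqr_ge0 (y - 25 / 4); nra.
  by move=> /(ler_wpM2l (ltW a'0)); nra.
Qed.

(** Along a geometric sequence [y, r * y, ...] a weight bounded by [2 * y] and
    [32 / y] is dominated by the increments of the bounded increasing function
    [y / (4 + y)], which avoids splitting the sum at [y = 4]. *)
Lemma grid_weight_telescope y r (h : R) : 0 < y -> 1 < r ->
  0 <= h -> h <= 2 * y -> h * y <= 32 ->
  h <= 16 * (1 + r) / (r - 1) * (r * y / (4 + r * y) - y / (4 + y)).
Proof.
move=> y0 r1 h0 h2 h32.
have r0 : 0 < r by lra.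
have ry0 : 0 < r * y by exact: mulr_gt0.
have -> : 16 * (1 + r) / (r - 1) * (r * y / (4 + r * y) - y / (4 + y)) =
    64 * (1 + r) * y / ((4 + y) * (4 + r * y)).
  by field; rewrite !gt_eqF//; nra.
rewrite ler_pdivlMr; last by rewrite mulr_gt0; lra.
case: (lerP y 4) => y4; last first.
  have : (4 + y) * (4 + r * y) <= 2 * (1 + r) * y * y by nra.
  move=> /(ler_wpM2l h0) /le_trans; apply.
  have : h * y * (2 * (1 + r) * y) <= 32 * (2 * (1 + r) * y).
    by rewrite ler_wpM2r// !mulr_ge0//; lra.
  nra.
have : (4 + y) * (4 + r * y) <= 32 * (1 + r) by nra.
move=> /(ler_wpM2l h0) /le_trans; apply.
have : h * (32 * (1 + r)) <= 2 * y * (32 * (1 + r)).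
  by rewrite ler_wpM2r//; lra.
nra.
Qed.

End grid.

Lemma geometric_cover (R : realType) (r x : R) (K : nat) :
  1 <= x -> x < r ^+ (4 * K) ->
  exists2 k, (k < K)%N & r ^+ (4 * k) <= x <= r ^+ (4 * k.+1).
Proof.
move=> x1; elim: K => [|K IH] xr; first by move: xr; rewrite muln0 expr0 ltNge x1.
case: (ltrP x (r ^+ (4 * K))) => [/IH[k kK kx]|xK].
  by exists k => //; exact: ltnW.
by exists K => //; rewrite xK ltW.
Qed.

Lemma geometric_unbounded (R : realType) (r x : R) : 1 < r ->
  exists K, x < r ^+ (4 * K).
Proof.
move=> r1; have bern K : 1 + K%:R * (r - 1) <= r ^+ K.
  elim: K => [|K IH]; first by rewrite mul0r addr0 expr0.
  have r0 : 0 <= r by lra.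
  have := ler_wpM2l r0 IH; rewrite exprS -natr1.
  have := mulr_ge0 (ler0n R K) (sqr_ge0 (r - 1)); nra.
have := truncnS_gt (x / (r - 1)); set K := _.+1 => xK; exists K.
have {xK} : x < K%:R * (r - 1) by rewrite -ltr_pdivrMr//; lra.
have := bern (4 * K)%N; rewrite natrM; have := ler0n R K; nra.
Qed.

(** With [rho ^ 2 = 1 / (4 * L)] the loss [exp (rho ^ 2 * L)] caused by the
    factor [1 - rho ^ 2] of the exponent is a constant, for a number of cells per
    unit of logarithmic scale of order [sqrt L]. *)
Definition grid_step (R : realType) (L : R) : R := (2 * Num.sqrt L)^-1.

(** The exponent [c] of [line_below_boundary] for the [k]-th cell, centered
    at [n = r ^ (4 * k + 2)]. *)
Definition grid_exponent (R : realType) (eps T rho : R) (k : nat) : R :=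
  let r := 1 + rho in
  let n := r ^+ (4 * k + 2) in
  (1 - rho ^+ 2) * (eps ^+ 2 * n / (2 * r ^+ 2) + ln (T / (n * r ^+ 2))).

(** Each term is [exp (- L) * exp (1 / 4) * h], where [h] is the weight of
    [grid_weight_bound] at [y k = eps * r ^ (2 * k + 2)]. *)
Lemma grid_sum (R : realType) (eps T : R) (K : nat) : 0 < eps -> 0 < T ->
  2 <= ln (T * eps ^+ 2) ->
  \sum_(0 <= k < K)
    expR (- grid_exponent eps T (grid_step (ln (T * eps ^+ 2))) k) <=
  (48 * Num.sqrt (ln (T * eps ^+ 2)) + 24) / (T * eps ^+ 2).
Proof.
move=> eps0 T0; set L := ln _ => L2; set rho := grid_step L.
pose r := 1 + rho.
have sL0 : 0 < Num.sqrt L by rewrite sqrtr_gt0; lra.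
have sL2 : Num.sqrt L ^+ 2 = L by rewrite sqr_sqrtr//; lra.
have rho0 : 0 < rho by rewrite invr_gt0; lra.
have rhoL : rho * Num.sqrt L = 1 / 2 by rewrite /rho /grid_step; field; rewrite gt_eqF.
have rho2L : rho ^+ 2 * L = 1 / 4 by rewrite -sL2 -exprMn rhoL; field.
have rho2 : rho ^+ 2 <= 1 / 8 by have := sqr_ge0 rho; nra.
have rho1 : rho < 2 / 5 by have := sqr_ge0 rho; nra.
have r1 : 1 < r by rewrite /r; lra.
have r0 : 0 < r by lra.
have r2 : r ^+ 2 <= 2 by rewrite /r; nra.
have r4 : 1 <= r ^+ 4 <= 4.
  have : 1 <= r ^+ 2 by nra.
  by rewrite (_ : r ^+ 4 = r ^+ 2 * r ^+ 2) -?exprD//; nra.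
have Te0 : 0 < T * eps ^+ 2 by rewrite mulr_gt0 ?exprn_gt0.
have eL : expR (- L) = (T * eps ^+ 2)^-1 by rewrite expRN lnK.
pose y k : R := eps * r ^+ (2 * k + 2).
have y0 k : 0 < y k by rewrite mulr_gt0 ?exprn_gt0.
have yS k : y k.+1 = r ^+ 2 * y k.
  by rewrite /y mulrCA -exprD; congr (_ * _ ^+ _); lia.
pose h k := expR ((1 - rho ^+ 2) * (ln (y k ^+ 2) - y k ^+ 2 / (2 * r ^+ 4))).
have termE k : expR (- grid_exponent eps T rho k) =
    (T * eps ^+ 2)^-1 * expR (1 / 4) * h k.
  rewrite -eL /h -!expRD /grid_exponent -/r; congr expR.
  have yE : y k ^+ 2 = eps ^+ 2 * (r ^+ (4 * k + 2) * r ^+ 2).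
    by rewrite -exprD /y exprMn -exprM; congr (_ * _ ^+ _); lia.
  have n0 : 0 < r ^+ (4 * k + 2) by exact: exprn_gt0.
  have r4E : r ^+ 4 = r ^+ 2 * r ^+ 2 by rewrite -exprD.
  set n := r ^+ (4 * k + 2) in yE n0 *.
  have -> : eps ^+ 2 * n / (2 * r ^+ 2) = y k ^+ 2 / (2 * r ^+ 4).
    by rewrite yE r4E; field; rewrite gt_eqF.
  have -> : T / (n * r ^+ 2) = T * eps ^+ 2 / y k ^+ 2.
    by rewrite yE; field; rewrite !gt_eqF.
  rewrite ln_div ?posrE ?exprn_gt0// -/L.
  set l := ln (y k ^+ 2); set v := y k ^+ 2 / _.
  rewrite -rho2L; ring.
have hb k : h k <= 16 * (1 + r ^+ 2) / (r ^+ 2 - 1) *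
    (y k.+1 / (4 + y k.+1) - y k / (4 + y k)).
  have [] := @grid_weight_bound R (y k) (rho ^+ 2) (r ^+ 4) (y0 k) _ r4.
    by rewrite sqr_ge0.
  rewrite -/(h k) yS => h2 h32; apply: grid_weight_telescope => //; first by nra.
  exact: expR_ge0.
under eq_bigr do rewrite termE.
rewrite -mulr_sumr.
have sum_h : \sum_(0 <= k < K) h k <= 16 * (1 + 2 * Num.sqrt L).
  apply: (@le_trans _ _ (\sum_(0 <= k < K) (16 * (1 + r ^+ 2) / (r ^+ 2 - 1) *
    (y k.+1 / (4 + y k.+1) - y k / (4 + y k))))); first by apply: ler_sum.
  rewrite -mulr_sumr (telescope_sumr (fun k => y k / (4 + y k)))//.
  have -> : 1 + 2 * Num.sqrt L = (1 + rho) / rho.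
    by rewrite /rho /grid_step; field; rewrite gt_eqF.
  have : y K / (4 + y K) - y 0%N / (4 + y 0%N) <= 1.
    have := y0 K; have := y0 0%N => a b.
    have : 0 <= y 0%N / (4 + y 0%N) by rewrite divr_ge0; lra.
    have : y K / (4 + y K) <= 1 by rewrite ler_pdivrMr; lra.
    lra.
  have c0 : 0 <= 16 * (1 + r ^+ 2) / (r ^+ 2 - 1) by rewrite divr_ge0; nra.
  move=> /(ler_wpM2l c0) /le_trans; apply; rewrite mulr1.
  rewrite ler_pdivrMr; last by nra.
  have -> : 16 * ((1 + rho) / rho) * (r ^+ 2 - 1) = 16 * ((1 + rho) * (2 + rho)).
    by rewrite /r; field; rewrite gt_eqF.
  by rewrite /r; nra.
have e14 : expR (1 / 4 : R) <= 3 / 2.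
  have := expR_ge1Dx (- (1 / 4) : R); have := expRxMexpNx_1 (1 / 4 : R).
  have := expR_gt0 (1 / 4 : R); nra.
rewrite -mulrA [leRHS]mulrC ler_pM2l ?invr_gt0//.
have h0 : 0 <= \sum_(0 <= k < K) h k by apply: sumr_ge0 => k _; exact: expR_ge0.
have := expR_gt0 (1 / 4 : R); nra.
Qed.

(** The primitive of [exp (- t ^ 2)]: its total variation is known, and its
    increments are bounded below because the integrand decreases. *)
Lemma gauss_primitive (R : realType) : exists Phi : R -> R,
  [/\ Phi 0 = 0, forall v, 0 <= v -> 0 <= Phi v <= Num.sqrt pi / 2 &
   forall v0 v1, 0 <= v0 <= v1 ->
     expR (- v1 ^+ 2) * (v1 - v0) <= Phi v1 - Phi v0].
Proof.
have itg (i : interval R) :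
    lebesgue_measure.-integrable [set` i] (EFin \o @gauss_fun R).
  by apply: (integrableS measurableT) => //; exact: integrableT_gauss.
exists (fun v => \int[lebesgue_measure]_(t in `[0, v]) gauss_fun t); split.
- by rewrite set_itv1 Rintegral_set1.
- move=> v v0; apply/andP; split.
    by apply: Rintegral_ge0 => t _; exact: gauss_fun_ge0.
  rewrite /Rintegral -[leRHS]/(fine (Num.sqrt pi / 2)%:E) -integral0y_gauss.
  apply: fine_le.
  - exact: (integrable_fin_num _ (itg `[0, v])).
  - exact: (integrable_fin_num _ (itg `[0, +oo[)).
  apply: ge0_subset_integral => //=.
  - apply/measurable_EFinP; apply: measurable_funTS; exact: measurable_gauss_fun.
  - by move=> t _; rewrite lee_fin gauss_fun_ge0.
  - by move=> t /=; rewrite !in_itv /= andbT => /andP[].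
move=> v0 v1 /andP[v00 v01].
rewrite Rintegral_itvB ?bnd_simp//.
have mI : lebesgue_measure.-integrable `]v0, v1]%classic
    (EFin \o cst (expR (- v1 ^+ 2)) : R -> \bar R).
  apply/integrableP; split; first exact/measurable_EFinP.
  rewrite (_ : (fun t : R => `|(EFin \o cst (expR (- v1 ^+ 2))) t|%E) =
    cst `|(expR (- v1 ^+ 2))%:E|%E)// integral_cst//= lebesgue_measure_itv /=.
  case: ifP => _.
    by rewrite -EFinD -EFinM ltry.
  by rewrite mule0.
have -> : expR (- v1 ^+ 2) * (v1 - v0) =
    \int[lebesgue_measure]_(t in `]v0, v1]) cst (expR (- v1 ^+ 2)) t.
  have mE : lebesgue_measure (`]v0, v1]%classic : set R) = (v1 - v0)%:E.
    rewrite lebesgue_measure_itv /= lte_fin.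
    move: v01; rewrite le_eqVlt => /predU1P[->|->]; last by rewrite -EFinD.
    by rewrite ltxx subrr.
  by rewrite Rintegral_cst// -[in LHS]/(fine (v1 - v0)%:E) -mE.
apply: le_Rintegral => // t /=; rewrite in_itv /= => /andP[t0 t1].
rewrite /gauss_fun ler_expR lerN2; nra.
Qed.

(** * Summing Gaussian tails *)

(** The Chernoff bound for the index of the other arm to exceed its mean by
    [de] after [s] draws, when the bonus is at most [sqrt (2 * A / s)]. *)
Definition tail_bound (R : realType) (A de : R) (s : nat) : R :=
  let v := de * Num.sqrt (s%:R / 2) - Num.sqrt A in
  if v <= 0 then 1 else expR (- v ^+ 2).

(** Comparison with an integral. In the variable [v], the antiderivative of
    [tail_bound] with respect to [s] is [s] up to the point [s = 2 * A / de ^ 2]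
    where [v] vanishes, and
    [D v := 2 / de ^ 2 * (1 - exp (- v ^ 2) + 2 * sqrt A * Phi v)] after it,
    since [s = 2 / de ^ 2 * (v + sqrt A) ^ 2]. Its increments dominate the terms
    of the sum, and its limit is the claimed bound. *)
Lemma tail_sum (R : realType) (A de : R) (T : nat) : 0 <= A -> 0 < de ->
  \sum_(1 <= s < T) tail_bound A de s <=
  (2 * A + 2 + 2 * Num.sqrt (pi * A)) / de ^+ 2.
Proof.
move=> A0 de0.
have [Phi [Phi0 Phi_bnd Phi_incr]] := gauss_primitive R.
set a := Num.sqrt A; have a0 : 0 <= a by exact: sqrtr_ge0.
have a2 : a ^+ 2 = A by exact: sqr_sqrtr.
have d2 : 0 < de ^+ 2 by exact: exprn_gt0.
(* The number of draws as a function of [v]. *)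
pose w (v : R) := 2 / de ^+ 2 * (v + a) ^+ 2.
pose D (v : R) := 2 / de ^+ 2 * (1 - expR (- v ^+ 2) + 2 * a * Phi v).
have c0 : 0 < 2 / de ^+ 2 by exact: divr_gt0.
have key v0 v1 : 0 <= v0 <= v1 ->
    expR (- v1 ^+ 2) * (w v1 - w v0) <= D v1 - D v0.
  move=> v01; have := Phi_incr _ _ v01; case/andP: v01 => v00 v01 inc.
  have -> : expR (- v1 ^+ 2) * (w v1 - w v0) = 2 / de ^+ 2 *
      (expR (- v1 ^+ 2) * (v1 ^+ 2 - v0 ^+ 2) +
       2 * a * (expR (- v1 ^+ 2) * (v1 - v0))).
    by rewrite /w; ring.
  have -> : D v1 - D v0 = 2 / de ^+ 2 *
      (expR (- v0 ^+ 2) - expR (- v1 ^+ 2) + 2 * a * (Phi v1 - Phi v0)).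
    by rewrite /D; ring.
  rewrite ler_pM2l// lerD//; last by rewrite ler_wpM2l// mulr_ge0.
  have -> : expR (- v0 ^+ 2) = expR (- v1 ^+ 2) * expR (v1 ^+ 2 - v0 ^+ 2).
    by rewrite -expRD; congr expR; ring.
  have := expR_ge1Dx (v1 ^+ 2 - v0 ^+ 2); have := expR_gt0 (- v1 ^+ 2); nra.
have D0 : D 0 = 0 by rewrite /D Phi0 expr0n oppr0 expR0; ring.
have w0 : w 0 = 2 / de ^+ 2 * A by rewrite /w add0r a2.
pose v (s : nat) : R := de * Num.sqrt (s%:R / 2) - a.
have wv s : w (v s) = s%:R.
  by rewrite /w /v subrK exprMn sqr_sqrtr ?divr_ge0//; field; rewrite gt_eqF.
have vS s : v s <= v s.+1.
  by rewrite lerD2r ler_pM2l// ler_sqrt ?divr_ge0// ler_pM2r// ler_nat.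
have va s : 0 <= v s + a by rewrite subrK mulr_ge0 ?sqrtr_ge0// ltW.
have w_le s : v s <= 0 -> s%:R <= w 0.
  move=> vs; rewrite -wv ler_pM2l// ler_pXn2r ?nnegrE ?add0r//.
  by rewrite -[leRHS]add0r lerD2r.
pose H s := if v s <= 0 then s%:R else w 0 + D (v s).
have sum_le m : \sum_(1 <= s < m.+1) tail_bound A de s <= H m.
  elim: m => [|m IH].
    rewrite big_nil /H ifT// /v mul0r sqrtr0 mulr0 sub0r oppr_le0//.
  rewrite big_nat_recr//=; apply: le_trans (lerD IH (lexx _)) _.
  rewrite /tail_bound /H -/a -/(v m.+1).
  case: (lerP (v m.+1) 0) => v1.
    by rewrite (le_trans (vS m) v1) natr1.
  have e0 := expR_gt0 (- v m.+1 ^+ 2).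
  have e1 : expR (- v m.+1 ^+ 2) <= 1 by rewrite -expR0 ler_expR oppr_le0 sqr_ge0.
  case: (lerP (v m) 0) => v0.
    have := key 0 (v m.+1); rewrite lexx ltW// D0 wv => /(_ isT).
    by have := w_le _ v0; rewrite -natr1; nra.
  have := key (v m) (v m.+1); rewrite ltW// vS !wv => /(_ isT).
  by rewrite -natr1; nra.
case: T => [|m].
  rewrite big_geq// divr_ge0 ?(ltW d2)// addr_ge0 ?mulr_ge0 ?sqrtr_ge0//.
  by rewrite addr_ge0// mulr_ge0.
apply: le_trans (sum_le m) _.
have -> : (2 * A + 2 + 2 * Num.sqrt (pi * A)) / de ^+ 2 =
    w 0 + 2 / de ^+ 2 * (1 + 2 * a * (Num.sqrt pi / 2)).
  by rewrite w0 sqrtrM ?pi_ge0// -/a; field; rewrite gt_eqF.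
have b0 : 0 <= 2 * a * (Num.sqrt pi / 2).
  by rewrite !mulr_ge0 ?sqrtr_ge0.
rewrite /H; case: (lerP (v m) 0) => vm.
  by rewrite (le_trans (w_le _ vm))// ler_wpDr// mulr_ge0// ?(ltW c0)// addr_ge0.
have := expR_ge0 (- v m ^+ 2); have /andP[_] := Phi_bnd _ (ltW vm).
have a20 : 0 <= 2 * a by exact: mulr_ge0.
by move=> /(ler_wpM2l a20) ? ?; rewrite lerD2l ler_pM2l//; lra.
Qed.

(** * Probabilities of the index events *)

Section bandit.
Context (R : realType) (d : measure_display) (Omega : measurableType d).
Context (P : probability Omega R) (d' : measure_display) (V : measurableType d').
Context (mu : 'I_2 -> R) (X : 'I_2 -> nat -> {RV P >-> R}) (U : {mfun Omega >-> V}).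
Hypothesis bandit : gaussian_bandit mu X U.

Definition centered_sum (i : 'I_2) (s : nat) (w : Omega) : R :=
  \sum_(0 <= k < s) (X i k w - mu i).

Lemma measurable_centered_sum i s : measurable_fun setT (centered_sum i s).
Proof. by apply: measurable_sum => k; exact: measurable_funB. Qed.

Lemma stack_indexE T i s w : (0 < s)%N ->
  stack_index T ((X i)^~ w) s =
  mu i + (centered_sum i s w + Num.sqrt (2 * s%:R * ln (T%:R / s%:R))) / s%:R.
Proof.
move=> s0; rewrite /stack_index /centered_sum sumrB sumr_const_nat subn0.
have s0' : 0 < s%:R :> R by rewrite ltr0n.
have -> : Num.sqrt (2 * s%:R * ln (T%:R / s%:R)) =
    s%:R * Num.sqrt (2 / s%:R * ln (T%:R / s%:R)) :> R.
  set l := ln _.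
  have -> : 2 * s%:R * l = s%:R ^+ 2 * (2 / s%:R * l) :> R by field; rewrite gt_eqF.
  by rewrite sqrtrM ?sqr_ge0// sqrtr_sqr ger0_norm.
by rewrite -mulr_natl; field; rewrite gt_eqF.
Qed.

Lemma measurable_exists (Q : nat -> bool) (F : nat -> set Omega) :
  (forall s, measurable (F s)) -> measurable [set w | exists2 s, Q s & F s w].
Proof.
move=> mF; have -> : [set w | exists2 s, Q s & F s w] =
    \bigcup_(s in [set s | Q s]) F s.
  by apply/seteqP; split => w [s]; exists s.
by apply: bigcup_measurable.
Qed.

Lemma measurable_sum_ge i s (a l : R) :
  measurable [set w | a <= l * centered_sum i s w].
Proof.
rewrite -[X in measurable X]setTI; apply: measurable_fun_le => //.
by apply: measurable_funM => //; exact: measurable_centered_sum.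
Qed.

Lemma centered_sum_line_crossing i (lam c : R) N :
  (P [set w | exists2 s, (s <= N)%N &
      c <= lam * centered_sum i s w - s%:R * (lam ^+ 2 / 2)]%R
   <= (expR (- c))%:E)%E.
Proof. exact: line_crossing bandit. Qed.

Lemma measurable_line_crossing i (lam c : R) N :
  measurable [set w | exists2 s, (s <= N)%N &
      c <= lam * centered_sum i s w - s%:R * (lam ^+ 2 / 2)]%R.
Proof.
apply: (@measurable_exists _ (fun s => [set w |
  c <= lam * centered_sum i s w - s%:R * (lam ^+ 2 / 2)])) => s.
rewrite -[X in measurable X]setTI; apply: measurable_fun_le => //.
apply: measurable_funB => //; apply: measurable_funM => //.
exact: measurable_centered_sum.
Qed.

Lemma union_bound (A : set Omega) (B : nat -> set Omega) (f : nat -> R) K :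
  measurable A -> (forall k, measurable (B k)) ->
  A `<=` \bigcup_(k in [set k | (k < K)%N]) B k ->
  (forall k, (P (B k) <= (f k)%:E)%E) ->
  (P A <= (\sum_(0 <= k < K) f k)%:E)%E.
Proof.
move=> mA mB AB PB.
apply: (@le_trans _ _ (\sum_(k < K) P (B k))%E).
  apply: content_subadditive => //.
  by rewrite -bigcup_mkord.
by rewrite big_mkord -sumEFin; apply: lee_sum.
Qed.

(** If the exponent is negative the bound is trivial; otherwise crossing the
    boundary inside the cell implies crossing the line of
    [line_below_boundary]. *)
Lemma grid_cell_crossing i (eps rho : R) (T k : nat) :
  0 < eps -> 0 < rho < 1 ->
  (P [set w | exists2 s, [&& (0 < s)%N, (s < T)%N,
        (1 + rho) ^+ (4 * k) <= s%:R & s%:R <= (1 + rho) ^+ (4 * k.+1)] &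
      eps * s%:R + Num.sqrt (2 * s%:R * ln (T%:R / s%:R)) <=
        - 1 * centered_sum i s w]%R
   <= (expR (- grid_exponent eps T%:R rho k))%:E)%E.
Proof.
move=> eps0 rho01; set r := 1 + rho; set B := [set w | _].
have mB : measurable B.
  apply: (@measurable_exists _ (fun s => [set w | eps * s%:R +
    Num.sqrt (2 * s%:R * ln (T%:R / s%:R)) <= - 1 * centered_sum i s w])) => s.
  exact: measurable_sum_ge.
set c := grid_exponent _ _ _ _.
case: (lerP c 0) => c0.
  apply: (@le_trans _ _ 1%E); first exact: probability_le1.
  by rewrite lee_fin -[leLHS]expR0 ler_expR oppr_ge0.
pose n : R := r ^+ (4 * k + 2).
have r0 : 0 < r by rewrite /r; lra.
have n0 : 0 < n by exact: exprn_gt0.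
pose lam := - Num.sqrt (2 * c / n).
apply: le_trans (centered_sum_line_crossing i lam c T).
apply: le_measure; rewrite ?inE//; first exact: measurable_line_crossing.
move=> w [s /and4P[s0 sT rs sr] H]; exists s; first exact: ltnW.
have s0' : 0 < s%:R :> R by rewrite ltr0n.
have T0' : 0 < T%:R :> R by rewrite ltr0n (ltn_trans s0).
have sT' : s%:R <= T%:R :> R by rewrite ler_nat ltnW.
have ns : n <= s%:R * r ^+ 2.
  by rewrite /n exprD ler_wpM2r// ltW// exprn_gt0.
have sn : s%:R <= n * r ^+ 2.
  by rewrite /n -exprD (_ : (4 * k + 2 + 2)%N = (4 * k.+1)%N)//; lia.
have := @line_below_boundary _ eps T%:R n s%:R rho c _ eps0 T0' n0 s0' rho01 sT'
  ns sn erefl c0 H.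
by rewrite /lam sqrrN mulN1r mulrN mulNr.
Qed.

(** Union bound over the cells of the grid; finitely many of them cover the
    integers below [T]. *)
Lemma best_index_low i (eps : R) (T : nat) : 0 < eps ->
  2 <= ln (T%:R * eps ^+ 2) ->
  (P [set w | exists2 s, (0 < s < T)%N &
      stack_index T ((X i)^~ w) s < mu i - eps]%R <=
   ((48 * Num.sqrt (ln (T%:R * eps ^+ 2)) + 24) / (T%:R * eps ^+ 2))%:E)%E.
Proof.
move=> eps0 L2; set L := ln _ in L2 *.
(* For [T = 0] the event is empty, and the bound is [0] because [0^-1 = 0]. *)
have [->|T0] := posnP T.
  rewrite (_ : [set w | _] = set0) ?measure0; last first.
    by apply/seteqP; split => // w [s]; rewrite ltn0 andbF.
  by rewrite mul0r invr0 mulr0.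
have T0' : 0 < T%:R :> R by rewrite ltr0n.
set A := [set w | _].
have AE : A = [set w | exists2 s, (0 < s < T)%N &
    eps * s%:R + Num.sqrt (2 * s%:R * ln (T%:R / s%:R)) <
      - 1 * centered_sum i s w].
  have equiv s w : (0 < s)%N -> (stack_index T ((X i)^~ w) s < mu i - eps) =
      (eps * s%:R + Num.sqrt (2 * s%:R * ln (T%:R / s%:R)) <
       - 1 * centered_sum i s w).
    move=> s0; have s0' : 0 < s%:R :> R by rewrite ltr0n.
    rewrite stack_indexE// ltrD2l ltr_pdivrMr//.
    by apply/idP/idP; lra.
  by apply/seteqP; split => w [s sT H]; exists s => //; move: H;
    have /andP[s0 _] := sT; rewrite equiv.
have mA : measurable A.
  rewrite AE; apply: (@measurable_exists _ (fun s => [set w | eps * s%:R +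
    Num.sqrt (2 * s%:R * ln (T%:R / s%:R)) < - 1 * centered_sum i s w])) => s.
  have -> : [set w | eps * s%:R + Num.sqrt (2 * s%:R * ln (T%:R / s%:R)) <
      - 1 * centered_sum i s w] = ~` [set w | - (eps * s%:R +
      Num.sqrt (2 * s%:R * ln (T%:R / s%:R))) <= 1 * centered_sum i s w].
    apply/seteqP; split => w /=; set q := _ + _.
      by move=> H; apply/negP; rewrite -ltNge; lra.
    by move=> /negP; rewrite -ltNge; lra.
  by apply: measurableC; exact: measurable_sum_ge.
have sL0 : 1 < Num.sqrt L by rewrite -[ltLHS]sqrtr1 ltr_sqrt; lra.
have rho01 : 0 < grid_step L < 1.
  by rewrite /grid_step invr_gt0 invf_lt1 ?mulr_gt0//; lra.
have r1 : 1 < 1 + grid_step L by lra.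
have [K TK] := geometric_unbounded T%:R r1.
apply: le_trans (_ : _ <= (\sum_(0 <= k < K)
  expR (- grid_exponent eps T%:R (grid_step L) k))%:E)%E _; last first.
  by rewrite lee_fin; exact: grid_sum.
apply: (union_bound (B := fun k => [set w | exists2 s,
    [&& (0 < s)%N, (s < T)%N, (1 + grid_step L) ^+ (4 * k) <= s%:R &
        s%:R <= (1 + grid_step L) ^+ (4 * k.+1)] &
      eps * s%:R + Num.sqrt (2 * s%:R * ln (T%:R / s%:R)) <=
        - 1 * centered_sum i s w])) => //.
- move=> k; apply: (@measurable_exists _ (fun s => [set w | eps * s%:R +
    Num.sqrt (2 * s%:R * ln (T%:R / s%:R)) <= - 1 * centered_sum i s w])) => s.
  exact: measurable_sum_ge.
- rewrite AE => w [s /andP[s0 sT] H].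
  have s1 : 1 <= s%:R :> R by rewrite ler1n.
  have sr : s%:R < (1 + grid_step L) ^+ (4 * K).
    by rewrite (lt_trans _ TK)// ltr_nat.
  have [k kK /andP[ks sk]] := geometric_cover s1 sr.
  by exists k => //; exists s; [rewrite s0 sT ks sk|exact: ltW].
- by move=> k; exact: grid_cell_crossing.
Qed.

(** If [v > 0] then [s > 2 * A / de ^ 2 >= 2 / de ^ 2], so that
    [ln (T / s) <= A] and the event forces [S s] above [2 * q * (de * q - sqrt A)]
    with [q := sqrt (s / 2)]. The optimal line at [s] bounds its probability. *)
Lemma other_index_high i (A de : R) (T s : nat) :
  0 < de -> 1 <= A -> T%:R * de ^+ 2 / 2 <= expR A -> (0 < s < T)%N ->
  (P [set w | mu i + de <= stack_index T ((X i)^~ w) s]%R <=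
   (tail_bound A de s)%:E)%E.
Proof.
move=> de0 A1 TA /andP[s0 sT].
set E := [set w | _]; have mE : measurable E.
  rewrite /E -[X in measurable X]setTI; apply: measurable_fun_le => //.
  exact: measurable_stack_index.
rewrite /tail_bound; set v := _ - _; case: (lerP v 0) => v0.
  exact: probability_le1.
have s0' : 0 < s%:R :> R by rewrite ltr0n.
have T0 : 0 < T%:R :> R by rewrite ltr0n (ltn_trans s0).
have q0 := sqrtr_ge0 (s%:R / 2 : R); have q2 : Num.sqrt (s%:R / 2) ^+ 2 = s%:R / 2 :> R.
  by rewrite sqr_sqrtr// divr_ge0.
have a0 := sqrtr_ge0 A; have a2 : Num.sqrt A ^+ 2 = A by rewrite sqr_sqrtr//; lra.
rewrite /v in v0 *; set q := Num.sqrt (s%:R / 2) in q0 q2 v0 *.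
set a := Num.sqrt A in a0 a2 v0 *.
have lA : ln (T%:R / s%:R) <= A.
  rewrite -[leRHS]expRK ler_ln ?posrE ?expR_gt0 ?divr_gt0//.
  apply: le_trans TA; rewrite ler_pdivrMr//.
  have : 1 <= de ^+ 2 * s%:R / 2.
    rewrite -mulrA -q2 -exprMn; nra.
  by move=> /(ler_wpM2l (ltW T0)); lra.
have bonus : Num.sqrt (2 * s%:R * ln (T%:R / s%:R)) <= 2 * q * a.
  rewrite -[leRHS]ger0_norm; last by rewrite !mulr_ge0.
  rewrite -sqrtr_sqr ler_sqrt ?sqr_ge0//.
  by rewrite !exprMn q2 a2; have := ler_wpM2l (ltW s0') lA; lra.
pose t := 2 * q * (de * q - a).
pose lam := t / s%:R.
have q1 : 0 < q.
  by rewrite lt0r q0 andbT; apply/eqP => qE; move: v0; rewrite qE mulr0; lra.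
have t0 : 0 < t by rewrite !mulr_gt0.
apply: le_trans (centered_sum_line_crossing i lam ((de * q - a) ^+ 2) s).
apply: le_measure; rewrite ?inE//; first exact: measurable_line_crossing.
move=> w; rewrite /E /= stack_indexE// => H; exists s => //.
  have tS : t <= centered_sum i s w.
    move: H; rewrite lerD2l ler_pdivlMr//.
    have -> : t = de * s%:R - 2 * q * a.
      have -> : s%:R = 2 * q ^+ 2 by rewrite q2; field.
      by rewrite /t; ring.
    lra.
  have lam0 : 0 <= lam by rewrite divr_ge0// ltW.
  have := ler_wpM2l lam0 tS.
  have -> : lam * t = 2 * (de * q - a) ^+ 2.
    have sE : s%:R = 2 * q ^+ 2 by rewrite q2; field.
    by rewrite /lam /t sE; field; rewrite gt_eqF.
  have -> : s%:R * (lam ^+ 2 / 2) = (de * q - a) ^+ 2.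
    have sE : s%:R = 2 * q ^+ 2 by rewrite q2; field.
    by rewrite /lam /t sE; field; rewrite gt_eqF.
  lra.
Qed.

Lemma expected_draws_bound (T : nat) (p : strategy V R) (b o : 'I_2)
    (eps de A : R) :
  ucb_star T p -> 0 < eps -> 0 < de -> mu b - mu o = eps + de ->
  2 <= ln (T%:R * eps ^+ 2) ->
  1 <= A -> T%:R * de ^+ 2 / 2 <= expR A ->
  fine (\int[P]_w (draws (play p (U w) (fun i s => X i s w) T) o)%:R%:E)%E <=
  (48 * Num.sqrt (ln (T%:R * eps ^+ 2)) + 24) / eps ^+ 2 + 1 +
  (2 * A + 2 + 2 * Num.sqrt (pi * A)) / de ^+ 2.
Proof.
move=> hp eps0 de0 gap L2 A1 TA.
have A0 : 0 <= A by lra.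
have T0 : T%:R != 0 :> R.
  by apply/eqP => T0; move: L2; rewrite T0 mul0r ln0//; lra.
have high s : (0 < s < T)%N ->
    (P [set w | mu b - eps <= stack_index T ((X o)^~ w) s]%R <=
     (tail_bound A de s)%:E)%E.
  by rewrite (_ : mu b - eps = mu o + de); [exact: other_index_high|lra].
apply: le_trans (expected_draws_upper U hp (best_index_low b eps0 L2) high) _.
have := @tail_sum R A de T A0 de0.
set S := \sum_(_ <= _ < _) _.
have -> : T%:R * ((48 * Num.sqrt (ln (T%:R * eps ^+ 2)) + 24) / (T%:R * eps ^+ 2)) =
    (48 * Num.sqrt (ln (T%:R * eps ^+ 2)) + 24) / eps ^+ 2.
  by field; rewrite T0 gt_eqF.
lra.
Qed.

End bandit.

(** * A logarithmic number of draws is unavoidable *)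

Lemma last_draw (V : Type) (R : realType) (p : strategy V R) (u : V)
    (x : 'I_2 -> nat -> R) (i : 'I_2) (m T : nat) :
  (m < draws (play p u x T) i)%N ->
  exists t, [/\ (t < T)%N, p u (play p u x t) = i & draws (play p u x t) i = m].
Proof.
elim: T => // T IH; rewrite drawsS; case: eqP => [pi|_]; last first.
  by rewrite addn0 => /IH[t [tT pt dt]]; exists t; split=> //; exact: ltnW.
rewrite addn1 ltnS leq_eqVlt => /orP[/eqP ->|/IH[t [tT pt dt]]].
  by exists T.
by exists t; split=> //; exact: ltnW.
Qed.

(** Otherwise [b] has more than [T / 2 + 1] draws. In the round of its last
    draw, [b] has at least [T / 2] draws and an index at most [M], whereas [o] has
    fewer than [nu] draws and an index larger than [M]. *)
Lemma draws_lower (V : Type) (R : realType) (p : strategy V R) (u : V)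
    (x : 'I_2 -> nat -> R) (T : nat) (b o : 'I_2) (M nu : R) :
  (forall h : history R, (size h < T)%N ->
     forall i, (ucb_star_index T h i <= ucb_star_index T h (p u h))%E) ->
  b != o -> nu <= T%:R / 2 - 1 ->
  (forall s, T%:R / 2 <= s%:R :> R -> (s < T)%N -> stack_index T (x b) s <= M) ->
  (forall s, (0 < s)%N -> s%:R < nu -> M < stack_index T (x o) s) ->
  nu <= (draws (play p u x T) o)%:R.
Proof.
move=> hp bo nuT hb ho; rewrite leNgt; apply/negP => Nnu.
have := draws_two p u x T bo; set Nb := draws _ b; set No := draws _ o in Nnu *.
move=> NT.
have NTR : Nb%:R + No%:R = T%:R :> R by rewrite -natrD NT.
have T2 : T%:R / 2 < Nb%:R - 1 :> R by lra.
have Nb0 : (0 < Nb)%N.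
  by rewrite -(ltr0n R); have := ler0n R T; lra.
have Nblt : (Nb.-1 < Nb)%N by rewrite prednK.
have [t [tT pt dt]] := last_draw Nblt.
have := hp (play p u x t) _ o; rewrite size_play pt => /(_ tT).
rewrite !ucb_star_index_play dt.
have NbE : Nb.-1%:R = Nb%:R - 1 :> R by rewrite -[in RHS](prednK Nb0) -natr1 addrK.
have -> : (Nb.-1 == 0)%N = false.
  apply/negbTE; rewrite -lt0n -(ltr0n R) NbE; have := ler0n R T; lra.
case: ifPn => [|s0]; first by rewrite leye_eq.
rewrite lee_fin leNgt => /negP; apply.
apply: (@le_lt_trans _ _ M).
  apply: hb; first by rewrite NbE ltW.
  by rewrite -NT; lia.
apply: ho; first by rewrite lt0n.
by rewrite (le_lt_trans _ Nnu)// ler_nat draws_mono// ltnW.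
Qed.

(** For [s >= T / 2] the bonus is of order [sqrt (1 / T)]. *)
Lemma best_index_settled (R : realType) (T : nat) (m s zeta K S : R) :
  0 < zeta -> 0 <= K -> 16 / zeta ^+ 2 + 4 * K / zeta <= T%:R ->
  T%:R / 2 <= s -> s <= T%:R -> 0 < s -> S <= zeta * s + K ->
  m + (S + Num.sqrt (2 * s * ln (T%:R / s))) / s <= m + 2 * zeta.
Proof.
move=> z0 K0 TzK Ts sT s0 SK; rewrite lerD2l ler_pdivrMr//.
have sz : 8 / zeta ^+ 2 + 2 * K / zeta <= s.
  apply: le_trans Ts; have -> : 8 / zeta ^+ 2 + 2 * K / zeta =
    (16 / zeta ^+ 2 + 4 * K / zeta) / 2 by field; rewrite gt_eqF.
  by rewrite ler_pM2r.
have z2 : 0 < zeta ^+ 2 by exact: exprn_gt0.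
have h1 : 8 <= zeta ^+ 2 * s.
  have : 8 / zeta ^+ 2 <= s by have := divr_ge0 (mulr_ge0 (ler0n R 2) K0) (ltW z0); lra.
  by rewrite ler_pdivrMr// [s * _]mulrC.
have h2 : 2 * K <= zeta * s.
  have : 2 * K / zeta <= s by have := divr_ge0 (ler0n R 8) (ltW z2); lra.
  by rewrite ler_pdivrMr// [s * _]mulrC.
have l1 : ln (T%:R / s) <= 1.
  rewrite -[leRHS]expRK ler_ln ?posrE ?expR_gt0//; last by rewrite divr_gt0//; lra.
  have := expR_ge1Dx (1 : R); rewrite ler_pdivrMr//; nra.
have bonus : Num.sqrt (2 * s * ln (T%:R / s)) <= zeta * s / 2.
  rewrite -[leRHS]ger0_norm; last by rewrite !mulr_ge0// ltW.
  rewrite -sqrtr_sqr ler_sqrt ?sqr_ge0//.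
  have : 2 * s * ln (T%:R / s) <= 2 * s * 1 by rewrite ler_wpM2l// mulr_ge0// ltW.
  by move=> /le_trans; apply; nra.
lra.
Qed.

(** After dividing by [sqrt s], the claim is that [sqrt (2 * ln (T / s))]
    exceeds [g * sqrt s + K / sqrt s]; for [s] between [1] and [c * ln T] this
    follows from the same inequality with [sqrt (c * ln T)] for [sqrt s] and
    [K] for [K / sqrt s], as [ln s <= 2 * sqrt s]. *)
Lemma other_index_unsettled (R : realType) (T : nat) (m s c zeta K S g : R) :
  0 <= K -> 0 < c -> 0 < g -> 1 <= s -> 0 < ln (T%:R : R) -> s < c * ln T%:R ->
  (g * Num.sqrt c * Num.sqrt (ln T%:R) + K) ^+ 2 <
    2 * (ln T%:R - 2 * Num.sqrt c * Num.sqrt (ln T%:R)) ->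
  - (zeta * s + K) <= S ->
  m + g - zeta < m + (S + Num.sqrt (2 * s * ln (T%:R / s))) / s.
Proof.
move=> K0 c0 g0 s1 u0 snu big SK.
have s0 : 0 < s by lra.
have T0 : 0 < T%:R :> R.
  rewrite lt0r ler0n andbT; apply/eqP => E; move: u0; rewrite E ln0//; lra.
rewrite -addrA ltrD2l ltr_pdivlMr//.
set u := ln (T%:R : R) in u0 snu big *; set a := Num.sqrt c in big *.
set v := Num.sqrt u in big *.
have a0 : 0 < a by rewrite sqrtr_gt0.
have v0 : 0 < v by rewrite sqrtr_gt0.
have a2 : a ^+ 2 = c by rewrite sqr_sqrtr// ltW.
have v2 : v ^+ 2 = u by rewrite sqr_sqrtr// ltW.
pose q := Num.sqrt s; have q0 : 0 < q by rewrite sqrtr_gt0.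
have q2 : q ^+ 2 = s by rewrite sqr_sqrtr// ltW.
have q1 : 1 <= q by rewrite -[leLHS]sqrtr1 ler_sqrt// ltW.
have av0 : 0 < a * v by exact: mulr_gt0.
have qav : q < a * v.
  by rewrite -(@ltr_pXn2r _ 2)// ?nnegrE ?ltW// exprMn q2 a2 v2.
have lq : ln s <= 2 * (a * v).
  rewrite -q2 lnXn// mulr_natl -mulr_natl.
  have := ln_sublinear q0; lra.
have lE : ln (T%:R / s) = u - ln s by rewrite ln_div ?posrE.
have : g * s + K < Num.sqrt (2 * s * ln (T%:R / s)); last by lra.
have -> : 2 * s * ln (T%:R / s) = q ^+ 2 * (2 * (u - ln s)) by rewrite lE q2; ring.
rewrite sqrtrM ?sqr_ge0// sqrtr_sqr gtr0_norm//.
have : g * a * v + K < Num.sqrt (2 * (u - ln s)).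
  rewrite -[ltLHS]gtr0_norm ?ltr_wpDr ?mulr_gt0//.
  have := sqr_ge0 (g * a * v + K); move: big lq.
  set e2 := (_ + _) ^+ 2; set l := ln s => big lq e20.
  have e2u : e2 < 2 * (u - l) by lra.
  by rewrite -sqrtr_sqr ltr_sqrt -/e2//; lra.
rewrite -q2; set w := Num.sqrt _ => gw.
have := ltr_pM2l q0 (g * a * v + K) w; rewrite gw => /idP qgw.
have gq : g * q * q < g * q * (a * v) by rewrite ltr_pM2l// mulr_gt0.
have Kq : K <= q * K by rewrite ler_peMl.
nra.
Qed.

Lemma near_sqrt_ln (R : realType) (B : R) :
  \forall T \near \oo, B <= Num.sqrt (ln (T%:R : R)).
Proof.
near=> T.
have TB : expR (B ^+ 2) <= T%:R by near: T; exact: nbhs_infty_ger.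
have T0 : 0 < T%:R :> R by exact: lt_le_trans (expR_gt0 _) TB.
rewrite (le_trans (ler_norm B))// -sqrtr_sqr ler_sqrt.
  by rewrite -[leLHS]expRK ler_ln ?posrE ?expR_gt0.
by rewrite ln_ge0// (le_trans _ TB)// -[leLHS]expR0 ler_expR sqr_ge0.
Unshelve. all: by end_near. Qed.

Lemma ln_le_sqrt (R : realType) (x : R) : 0 < x -> ln x <= 2 * Num.sqrt x.
Proof.
move=> x0; have q0 : 0 < Num.sqrt x by rewrite sqrtr_gt0.
rewrite -[in ln x](sqr_sqrtr (ltW x0)) lnXn// -mulr_natl.
by have := ln_sublinear q0; lra.
Qed.

Section lower.
Context (R : realType) (d : measure_display) (Omega : measurableType d).
Context (P : probability Omega R) (d' : measure_display) (V : measurableType d').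
Context (mu : 'I_2 -> R) (X : 'I_2 -> nat -> {RV P >-> R}) (U : {mfun Omega >-> V}).
Hypothesis bandit : gaussian_bandit mu X U.

Lemma expected_draws_ge (T : nat) (p : strategy V R) (o : 'I_2) (E : set Omega)
    (nu q : R) :
  measurable_strategy p -> measurable E -> (P E <= q%:E)%E -> 0 <= nu ->
  (forall w, ~ E w -> nu <= (draws (play p (U w) (fun i s => X i s w) T) o)%:R) ->
  nu * (1 - q) <=
  fine (\int[P]_w (draws (play p (U w) (fun i s => X i s w) T) o)%:R%:E)%E.
Proof.
move=> mp mE PE nu0 hE.
set N := fun w => (draws (play p (U w) (fun i s => X i s w) T) o)%:R : R.
have mN : measurable_fun setT N by exact: measurable_draws.
have finN : (\int[P]_w (N w)%:E)%E \is a fin_num.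
  have /andP[N0 NT] := expected_draws_le X U mp T o.
  by rewrite ge0_fin_numE// (le_lt_trans NT)// ltry.
have mind : measurable_fun setT (fun w => nu * \1_E w : R).
  by apply: measurable_funM => //; exact: measurable_indic.
have emN : measurable_fun setT (fun w => (N w)%:E) by exact/measurable_EFinP.
have emind : measurable_fun setT (fun w => (nu * \1_E w)%:E : \bar R).
  exact/measurable_EFinP.
have indE : (\int[P]_w (nu * \1_E w)%:E <= (nu * q)%:E)%E.
  under eq_integral do rewrite EFinM.
  rewrite ge0_integralZl//; last by apply/measurable_EFinP; exact: measurable_indic.
  by rewrite integral_indic// setIT EFinM lee_pmul.
have total : (nu%:E <= \int[P]_w (N w)%:E + (nu * q)%:E)%E.
  apply: (@le_trans _ _ (\int[P]_w ((N w)%:E + (nu * \1_E w)%:E))%E).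
    have -> : nu%:E = (\int[P]_w nu%:E)%E.
      rewrite integral_cst// -[LHS]mule1; congr (_ * _)%E.
      exact/esym/probability_setT.
    apply: ge0_le_integral => //.
    - exact: emeasurable_funD.
    - move=> w _; rewrite -EFinD lee_fin indicE; case: (boolP (w \in E)) => [_|].
        by rewrite mulr1 lerDr.
      by rewrite notin_setE mulr0 addr0 => /hE.
  rewrite ge0_integralD//; first exact: leeD2l.
  - by move=> w _; rewrite lee_fin /N.
  - by move=> w _; rewrite lee_fin mulr_ge0.
rewrite -(fineK finN) -EFinD lee_fin in total.
by rewrite -/N; lra.
Qed.

(** The two linear bounds on the centered sums cost [3 * zeta] in total, so
    the index of [o] has to make up for [g := De + 3 * zeta]. As
    [g ^ 2 * c < 2], the quadratic inequality in [v := sqrt (ln T)] that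
    [other_index_unsettled] asks for holds for large [v]. *)
Lemma near_expected_draws_lower (b o : 'I_2) (kappa : R) :
  b != o -> mu o < mu b -> 0 < kappa < 1 ->
  \forall T \near \oo, forall p : strategy V R, ucb_star T p ->
    2 * (1 - kappa) / (mu b - mu o) ^+ 2 * ln T%:R <=
    fine (\int[P]_w (draws (play p (U w) (fun i s => X i s w) T) o)%:R%:E)%E.
Proof.
move=> bo mubo /andP[k0 k1].
set De := mu b - mu o; have De0 : 0 < De by rewrite subr_gt0.
(* The loss [kappa] is shared equally between the constant [c] and the
   probability of the exceptional event. *)
pose th := kappa / 2; have th0 : 0 < th by rewrite /th; lra.
have th1 : th < 1 / 2 by rewrite /th; lra.
pose zeta := De * th / 12; have z0 : 0 < zeta by rewrite divr_gt0// mulr_gt0.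
pose g := De + 3 * zeta; have g0 : 0 < g by rewrite /g; lra.
pose c := 2 * (1 - th) / De ^+ 2.
have c0 : 0 < c by rewrite divr_gt0 ?exprn_gt0// mulr_gt0//; lra.
(* Each of the two sums crosses its line with probability at most [th / 2]. *)
pose K := - ln (th / 2) / (2 * zeta).
have K0 : 0 <= K.
  rewrite divr_ge0//; last by rewrite mulr_ge0// ltW.
  by rewrite oppr_ge0 ln_le0//; lra.
have eK : expR (- (2 * zeta * K)) = th / 2.
  rewrite -[RHS]lnK ?posrE ?divr_gt0//; congr expR.
  by rewrite /K; field; rewrite gt_eqF.
pose a := Num.sqrt c; have a0 : 0 < a by rewrite sqrtr_gt0.
have a2 : a ^+ 2 = c by rewrite sqr_sqrtr// ltW.
pose D := 2 - g ^+ 2 * c.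
have D0 : 0 < D.
  have -> : D = 2 * (1 - (1 + th / 4) ^+ 2 * (1 - th)).
    by rewrite /D /g /c /zeta; field; rewrite gt_eqF.
  by rewrite mulr_gt0//; nra.
near=> T; move=> p [mp hp].
have T1 : 16 / zeta ^+ 2 + 4 * K / zeta <= T%:R.
  by near: T; exact: nbhs_infty_ger.
have T2 : (4 * c + 2) ^+ 2 <= T%:R by near: T; exact: nbhs_infty_ger.
have T3 : (4 * a + 2 * K * g * a + K ^+ 2) / D + 1 <= Num.sqrt (ln (T%:R : R)).
  by near: T; exact: near_sqrt_ln.
have T0 : 0 < T%:R :> R by rewrite (lt_le_trans _ T2)// exprn_gt0//; lra.
set v := Num.sqrt (ln (T%:R : R)) in T3.
have C0 : 0 <= 4 * a + 2 * K * g * a + K ^+ 2.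
  have := mulr_ge0 (mulr_ge0 K0 (ltW g0)) (ltW a0); have := sqr_ge0 K; lra.
have v1 : 1 <= v by rewrite (le_trans _ T3)// lerDr divr_ge0// ltW.
have u0 : 0 < ln (T%:R : R) by rewrite -sqrtr_gt0 -/v; lra.
have v2 : v ^+ 2 = ln (T%:R : R) by rewrite sqr_sqrtr// ltW.
set nu := c * ln (T%:R : R).
have nu0 : 0 <= nu by rewrite mulr_ge0// ltW.
have nuT : nu <= T%:R / 2 - 1.
  have := ln_le_sqrt T0; set q := Num.sqrt _ => lq.
  have q2 : q ^+ 2 = T%:R by rewrite sqr_sqrtr// ltW.
  have q0 : 0 <= q by exact: sqrtr_ge0.
  have qc : 4 * c + 2 <= q.
    by rewrite -(@ler_pXn2r _ 2) ?nnegrE// ?q2//; lra.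
  have := ler_wpM2l (ltW c0) lq; rewrite -/nu; nra.
have big : (g * Num.sqrt c * v + K) ^+ 2 <
    2 * (ln (T%:R : R) - 2 * Num.sqrt c * v).
  have Dv : 4 * a + 2 * K * g * a + K ^+ 2 + D <= D * v.
    have -> : 4 * a + 2 * K * g * a + K ^+ 2 + D =
      D * ((4 * a + 2 * K * g * a + K ^+ 2) / D + 1) by field; rewrite gt_eqF.
    by rewrite ler_pM2l.
  have vn : 0 <= v by lra.
  have := ler_wpM2r vn Dv.
  rewrite -/a -v2; have := ler_wpM2l (sqr_ge0 K) v1.
  have : D * v ^+ 2 = 2 * v ^+ 2 - (g * a * v) ^+ 2.
    by rewrite /D -a2; ring.
  have : 0 < D * v by rewrite mulr_gt0//; lra.
  nra.
pose ev i l := [set w | exists2 s, (s <= T)%N &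
  2 * zeta * K <= l * centered_sum mu X i s w - s%:R * (l ^+ 2 / 2)].
have mev i l : measurable (ev i l) by exact: measurable_line_crossing.
have Pev i l : (P (ev i l) <= (th / 2)%:E)%E.
  by rewrite -eK; exact: (centered_sum_line_crossing bandit).
pose E := ev b (2 * zeta) `|` ev o (- (2 * zeta)).
have PE : (P E <= th%:E)%E.
  apply: (le_trans (measureU2 P (mev b (2 * zeta)) (mev o (- (2 * zeta))))).
  have -> : th%:E = ((th / 2)%:E + (th / 2)%:E)%E by rewrite -EFinD; congr EFin; field.
  by apply: leeD; exact: Pev.
have mE : measurable E by exact: measurableU.
apply: le_trans (expected_draws_ge mp mE PE nu0 _).
  rewrite /nu /c /th.
  have -> : 2 * (1 - kappa / 2) / De ^+ 2 * ln (T%:R : R) * (1 - kappa / 2) =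
    2 * (1 - kappa / 2) ^+ 2 / De ^+ 2 * ln (T%:R : R) by field; rewrite gt_eqF.
  rewrite ler_pM2r// ler_pM2r ?invr_gt0 ?exprn_gt0//; nra.
move=> w nE.
have below i l s : (s <= T)%N -> ~ ev i l w ->
    l * centered_sum mu X i s w - s%:R * (l ^+ 2 / 2) < 2 * zeta * K.
  by move=> sT ne; rewrite ltNge; apply/negP => ge; apply: ne; exists s.
apply: (draws_lower (M := mu b + 2 * zeta) (hp (U w)) bo nuT).
- move=> s Ts sT.
  have s0 : 0 < s%:R :> R by lra.
  rewrite (stack_indexE mu) ?(ltr0n R)// -?(ltr0n R)//.
  apply: best_index_settled T1 Ts _ s0 _ => //; first by rewrite ler_nat ltnW.
  have := below b (2 * zeta) s (ltnW sT) (fun h => nE (or_introl h)).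
  by move=> lt; rewrite -(ler_pM2l z0); lra.
- move=> s s0 snu.
  have s1 : 1 <= s%:R :> R by rewrite ler1n.
  rewrite (stack_indexE mu)//.
  have -> : mu b + 2 * zeta = mu o + g - zeta by rewrite /g /De; ring.
  apply: (@other_index_unsettled R T (mu o) s%:R c zeta K _ g) => //.
  have sT : (s <= T)%N by rewrite -(ler_nat R); lra.
  have := below o (- (2 * zeta)) s sT (fun h => nE (or_intror h)).
  by rewrite sqrrN => lt; rewrite -(ler_pM2l z0); lra.
Unshelve. all: by end_near. Qed.

End lower.

(** * Asymptotic and minimax upper bounds *)

Lemma expR1_ge2 (R : realType) : 2 <= expR 1 :> R.
Proof. by have := expR_ge1Dx (1 : R); lra. Qed.

Lemma pi_le4 (R : realType) : pi <= 4 :> R.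
Proof. by have /andP[_] := @pihalf_02 R; lra. Qed.

Lemma best_arm (R : realType) (mu : 'I_2 -> R) :
  exists b o, [/\ b != o, mu o <= mu b & `|mu 0 - mu 1| = mu b - mu o].
Proof.
case: (leP (mu 1) (mu 0)) => h.
  by exists 0, 1; split=> //; rewrite ger0_norm// subr_ge0.
by exists 1, 0; split=> //; [exact: ltW|rewrite ltr0_norm ?opprB// subr_lt0].
Qed.

Section upper.
Context (R : realType) (d : measure_display) (Omega : measurableType d).
Context (P : probability Omega R) (d' : measure_display) (V : measurableType d').
Context (mu : 'I_2 -> R) (X : 'I_2 -> nat -> {RV P >-> R}) (U : {mfun Omega >-> V}).
Hypothesis bandit : gaussian_bandit mu X U.
Context (b o : 'I_2) (mubo : mu o < mu b).
Local Notation De := (mu b - mu o).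
Local Notation EN T p :=
  (fine (\int[P]_w (draws (play p (U w) (fun i s => X i s w) T) o)%:R%:E)%E).

Let De0 : 0 < De. Proof. by rewrite subr_gt0. Qed.

(** The hypothesis on [eps] makes [ln (T * De ^ 2 / 2)] at least [1]. *)
Lemma other_draws_upper (T : nat) (p : strategy V R) (eps : R) :
  ucb_star T p -> 0 < eps < De -> expR 1 ^+ 2 <= T%:R * eps ^+ 2 ->
  EN T p <= (48 * Num.sqrt (ln (T%:R * eps ^+ 2)) + 24) / eps ^+ 2 + 1 +
    (2 * ln (T%:R * De ^+ 2 / 2) + 2 +
     2 * Num.sqrt (pi * ln (T%:R * De ^+ 2 / 2))) / (De - eps) ^+ 2.
Proof.
move=> hp /andP[eps0 epsD] Teps.
have e2 := @expR1_ge2 R.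
have T0 : 0 <= T%:R :> R by [].
have lt : eps ^+ 2 <= De ^+ 2 by rewrite ler_pXn2r ?nnegrE ?ltW.
have TD := ler_wpM2l T0 lt.
have lt' : (De - eps) ^+ 2 <= De ^+ 2 by rewrite ler_pXn2r ?nnegrE//; lra.
have TD' := ler_wpM2l T0 lt'.
have TD0 : expR 1 <= T%:R * De ^+ 2 / 2 by nra.
have A1 : 1 <= ln (T%:R * De ^+ 2 / 2).
  by rewrite -[leLHS](@expRK R) ler_ln ?posrE ?expR_gt0//; lra.
apply: (expected_draws_bound bandit hp) => //; try lra.
- have -> : 2 = ln (expR 1 ^+ 2) :> R by rewrite lnXn ?expR_gt0// expRK.
  by rewrite ler_ln ?posrE// ?exprn_gt0 ?expR_gt0//; nra.
- by rewrite lnK ?posrE; lra.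
Qed.

Lemma sqrt_ln_scale (v C x : R) : 0 <= v -> 0 <= C -> x <= v ^+ 2 + C ->
  Num.sqrt x <= v + (C + 1).
Proof.
move=> v0 C0 xv; rewrite -[leRHS]ger0_norm; last by lra.
by rewrite -sqrtr_sqr ler_wsqrtr// (le_trans xv)//; nra.
Qed.

(** For [eps] a small enough multiple of the gap, the bound of
    [other_draws_upper] is [2 / de ^ 2 * ln T] plus a linear function of
    [sqrt (ln T)], where [2 / de ^ 2] is close to [2 / De ^ 2]. *)
Lemma near_other_draws_upper (kappa : R) : 0 < kappa ->
  \forall T \near \oo, forall p : strategy V R, ucb_star T p ->
    EN T p <= 2 * (1 + kappa) / De ^+ 2 * ln T%:R.
Proof.
move=> k0; pose k := kappa / 2; have k0' : 0 < k by exact: divr_gt0.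
(* Then [(1 + k) * (1 - th) ^ 2 >= 1]. *)
pose th := k / (2 * (1 + k)).
have th0 : 0 < th by rewrite divr_gt0// mulr_gt0//; lra.
have th1 : th < 1 by rewrite ltr_pdivrMr; lra.
pose eps := th * De; have eps0 : 0 < eps by exact: mulr_gt0.
have epsD : eps < De by rewrite /eps gtr_pMl.
pose de := De - eps; have de0 : 0 < de by rewrite subr_gt0.
have de2 : 2 / de ^+ 2 <= 2 * (1 + k) / De ^+ 2.
  rewrite ler_pdivrMr ?exprn_gt0//.
  have -> : 2 * (1 + k) / De ^+ 2 * de ^+ 2 = 2 * ((1 + k) * (1 - th) ^+ 2).
    by rewrite /de /eps; field; rewrite gt_eqF.
  have : (1 + k) * (1 - 2 * th) = 1.
    by rewrite /th; field; rewrite !gt_eqF//; lra.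
  have : (1 + k) * (1 - 2 * th) <= (1 + k) * (1 - th) ^+ 2.
    by rewrite ler_wpM2l//; nra.
  lra.
pose C := `|ln (eps ^+ 2)| + `|ln (De ^+ 2 / 2)|.
have C0 : 0 <= C by exact: addr_ge0.
pose K1 := 48 / eps ^+ 2 + 4 / de ^+ 2.
pose K2 := (48 * (C + 1) + 24) / eps ^+ 2 + 1 + (2 * C + 2 + 4 * (C + 1)) / de ^+ 2.
have ie : 0 < (eps ^+ 2)^-1 by rewrite invr_gt0 exprn_gt0.
have id : 0 < (de ^+ 2)^-1 by rewrite invr_gt0 exprn_gt0.
have K10 : 0 <= K1 by rewrite /K1; lra.
have K20 : 0 <= K2 by rewrite /K2; nra.
pose kD := 2 * k / De ^+ 2.
have kD0 : 0 < kD by rewrite divr_gt0 ?exprn_gt0// mulr_gt0.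
near=> T; move=> p hp.
have T1 : expR 1 ^+ 2 / eps ^+ 2 <= T%:R by near: T; exact: nbhs_infty_ger.
have T2 : (K1 + K2) / kD + 1 <= Num.sqrt (ln (T%:R : R)).
  by near: T; exact: near_sqrt_ln.
have Teps : expR 1 ^+ 2 <= T%:R * eps ^+ 2 by rewrite -ler_pdivrMr ?exprn_gt0.
have T0 : 0 < T%:R :> R by rewrite (lt_le_trans _ T1)// mulr_gt0 ?exprn_gt0 ?expR_gt0.
set v := Num.sqrt (ln (T%:R : R)) in T2.
have v1 : 1 <= v.
  have : 0 <= (K1 + K2) / kD by rewrite divr_ge0 ?(ltW kD0)// addr_ge0.
  lra.
have u0 : 0 < ln (T%:R : R) by rewrite -sqrtr_gt0 -/v; lra.
have v2 : v ^+ 2 = ln (T%:R : R) by rewrite sqr_sqrtr// ltW.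
have v0 : 0 <= v by lra.
apply: le_trans (other_draws_upper hp _ Teps) _; first by rewrite eps0.
have LC : ln (T%:R * eps ^+ 2) <= v ^+ 2 + C.
  rewrite lnM ?posrE ?exprn_gt0// v2 lerD2l /C.
  by have := ler_norm (ln (eps ^+ 2)); have := normr_ge0 (ln (De ^+ 2 / 2)); lra.
have AC : ln (T%:R * De ^+ 2 / 2) <= v ^+ 2 + C.
  rewrite -mulrA lnM ?posrE ?divr_gt0 ?exprn_gt0// v2 lerD2l /C.
  by have := ler_norm (ln (De ^+ 2 / 2)); have := normr_ge0 (ln (eps ^+ 2)); lra.
have sL := sqrt_ln_scale v0 C0 LC; have sA := sqrt_ln_scale v0 C0 AC.
set L := Num.sqrt (ln (T%:R * eps ^+ 2)) in sL *.
set A := ln (T%:R * De ^+ 2 / 2) in AC sA *.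
have sp : Num.sqrt (pi * A) <= 2 * (v + (C + 1)).
  rewrite sqrtrM ?pi_ge0//.
  have p2 : Num.sqrt pi <= 2 :> R.
    rewrite -[leRHS]ger0_norm// -sqrtr_sqr ler_wsqrtr//.
    by have := pi_le4 R; lra.
  by apply: ler_pM => //; exact: sqrtr_ge0.
have b1 : (48 * L + 24) / eps ^+ 2 <= (48 * (v + (C + 1)) + 24) / eps ^+ 2.
  by rewrite ler_pM2r//; lra.
have b2 : (2 * A + 2 + 2 * Num.sqrt (pi * A)) / de ^+ 2 <=
    (2 * (v ^+ 2 + C) + 2 + 2 * (2 * (v + (C + 1)))) / de ^+ 2.
  by rewrite ler_pM2r//; lra.
have b3 : (48 * (v + (C + 1)) + 24) / eps ^+ 2 + 1 +
    (2 * (v ^+ 2 + C) + 2 + 2 * (2 * (v + (C + 1)))) / de ^+ 2 =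
    2 / de ^+ 2 * v ^+ 2 + K1 * v + K2 by rewrite /K1 /K2; ring.
have b4 : K1 * v + K2 <= kD * v ^+ 2.
  have : K1 + K2 <= kD * v.
    have -> : K1 + K2 = kD * ((K1 + K2) / kD) by rewrite mulrC divfK// gt_eqF.
    by rewrite ler_pM2l//; lra.
  by move=> /(ler_wpM2r v0); have := ler_wpM2l K20 v1; nra.
have b5 := ler_wpM2r (sqr_ge0 v) de2.
have -> : 2 * (1 + kappa) / De ^+ 2 * ln (T%:R : R) =
    2 * (1 + k) / De ^+ 2 * v ^+ 2 + kD * v ^+ 2.
  by rewrite v2 /kD /k; field; rewrite gt_eqF.
rewrite -/de; lra.
Unshelve. all: by end_near. Qed.

(** With [z := De * sqrt T / 33 > 1], each term of [other_draws_upper] at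
    [eps := De / 2] is at most a constant times [z / De ^ 2]: the logarithms are
    at most [10 * z]. *)
Lemma other_draws_sqrt (T : nat) (p : strategy V R) :
  (1 <= T)%N -> ucb_star T p -> De * EN T p <= 33 * Num.sqrt T%:R + De.
Proof.
move=> T1 hp; have T0 : 0 < T%:R :> R by rewrite ltr0n.
set q := Num.sqrt T%:R; have q0 : 0 < q by rewrite sqrtr_gt0.
have q2 : q ^+ 2 = T%:R by rewrite sqr_sqrtr// ltW.
case: (lerP (De * q) 33) => [Dq|Dq].
  have [mp _] := hp; have /andP[N0 NT] := expected_draws_le X U mp T o.
  have EN_le : EN T p <= T%:R.
    by rewrite -lee_fin fineK// ge0_fin_numE// (le_lt_trans NT)// ltry.
  have : De * EN T p <= De * T%:R by rewrite ler_pM2l.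
  by rewrite -q2; have := De0; nra.
pose z := De * q / 33; have z1 : 1 < z by rewrite ltr_pdivlMr ?mul1r.
have Dq_z : De * q = 33 * z by rewrite /z; field.
have TDe : T%:R * De ^+ 2 = (33 * z) ^+ 2 by rewrite -Dq_z -q2; ring.
have lnz : ln z <= z - 1.
  have -> : ln z = ln (1 + (z - 1)) by congr ln; ring.
  by apply: le_ln1Dx; lra.
have ln2 : ln 2 <= 1 :> R.
  by rewrite -[leRHS](@expRK R) ler_ln ?posrE ?expR_gt0//; exact: expR1_ge2.
(* [33 ^ 2 / 2 <= 2 ^ 10], and [ln 2 <= 1]. *)
have lnA : ln (T%:R * De ^+ 2 / 2) <= 10 * z.
  apply: (@le_trans _ _ (ln (2 ^+ 10 * z ^+ 2))).
    have z2 : 0 < z ^+ 2 by rewrite exprn_gt0; lra.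
    rewrite TDe ler_ln ?posrE; [|by rewrite exprMn; nra..].
    by nra.
  have z0 : 0 < z by lra.
  have l2 : ln (2 ^+ 10) = 10 * ln 2 :> R by rewrite lnXn// mulr_natl.
  have lz : ln (z ^+ 2) = 2 * ln z by rewrite lnXn// mulr_natl.
  rewrite lnM ?posrE ?exprn_gt0// l2 lz; lra.
have lnL : ln (T%:R * (De / 2) ^+ 2) <= 10 * z.
  apply: le_trans lnA; have TD : 0 < T%:R * De ^+ 2 by rewrite mulr_gt0 ?exprn_gt0.
  by rewrite ler_ln ?posrE; nra.
have z2 : 10 * z <= 10 * z ^+ 2 by nra.
have sL : Num.sqrt (ln (T%:R * (De / 2) ^+ 2)) <= 4 * z.
  rewrite -[leRHS]ger0_norm; last by lra.
  by rewrite -sqrtr_sqr ler_wsqrtr//; nra.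
have sA : Num.sqrt (pi * ln (T%:R * De ^+ 2 / 2)) <= 7 * z.
  rewrite -[leRHS]ger0_norm; last by lra.
  rewrite -sqrtr_sqr ler_wsqrtr//.
  have := ler_wpM2l (pi_ge0 R) lnA; have := pi_le4 R; nra.
have e3 : expR 1 <= 4 :> R.
  have := expRxMexpNx_1 (1 / 2 : R); have := expR_ge1Dx (- (1 / 2) : R).
  have -> : expR 1 = expR (1 / 2) * expR (1 / 2) :> R.
    by rewrite -expRD; congr expR; field.
  have := expR_gt0 (1 / 2 : R); nra.
have Teps : expR 1 ^+ 2 <= T%:R * (De / 2) ^+ 2.
  by have := expR_gt0 (1 : R); nra.
have := other_draws_upper hp _ Teps; rewrite ltr_pdivrMr// ltr_pMr//.
rewrite divr_gt0//= (_ : (1 < 2) = true)//; last by lra.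
move=> /(_ isT); set L := Num.sqrt _ in sL *; set A := ln _ in lnA sA *.
set sp := Num.sqrt (pi * A) in sA *; set N := fine _ => NU.
have NU' : N <= 1 + 4 * ((48 * L + 24) + (2 * A + 2 + 2 * sp)) / De ^+ 2.
  by apply: le_trans NU _; rewrite le_eqVlt; apply/orP; left; apply/eqP; field;
    rewrite gt_eqF.
(* [1089 = 33 ^ 2]: this is the largest multiple of [z] that yields [33 * q]. *)
have : De * N <= De * (1 + 4 * (1089 / 4 * z) / De ^+ 2).
  rewrite ler_pM2l// (le_trans NU')// lerD2l ler_pM2r ?invr_gt0 ?exprn_gt0//.
  lra.
have -> : De * (1 + 4 * (1089 / 4 * z) / De ^+ 2) = 33 * q + De.
  have -> : 33 * q = 33 * (33 * z) / De by rewrite -Dq_z; field; rewrite gt_eqF.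
  by field; rewrite gt_eqF.
by [].
Qed.

End upper.

(** * Regret of the strategy *)

Theorem theorem8 (R : realType)
    (d : measure_display) (Omega : measurableType d) (P : probability Omega R)
    (d' : measure_display) (V : measurableType d')
    (mu : 'I_2 -> R) (X : 'I_2 -> nat -> {RV P >-> R}) (U : {mfun Omega >-> V})
    (ucb : nat -> strategy V R)
    (hbandit : gaussian_bandit mu X U)
    (hucb : forall T : nat, ucb_star T (ucb T)) :
  let Delta := `|mu 0 - mu 1| in
  let Reg (T : nat) : R := regret mu X U (ucb T) T in
  let e : R := expR 1 in
  [/\ 0 < Delta ->
      forall (T : nat) (eps : R), (1 <= T)%N -> 0 < eps < Delta ->
        2 <= T%:R * (Delta - eps) ^+ 2 ->
        e ^+ 2 <= T%:R * eps ^+ 2 ->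
        Reg T <=
          2 * ln (T%:R * Delta ^+ 2 / 2) / (Delta * (1 - eps / Delta) ^+ 2)
          + 2 * Num.sqrt (pi * ln (T%:R * Delta ^+ 2 / 2))
            / (Delta * (1 - eps / Delta) ^+ 2)
          + Delta * ((30 * e * Num.sqrt (ln (eps ^+ 2 * T%:R)) + 16 * e)
                     / eps ^+ 2)
          + 2 / (Delta * (1 - eps / Delta) ^+ 2)
          + Delta,
      0 < Delta ->
      limn_esup (fun T : nat => (Reg T / ln T%:R)%:E) = (2 / Delta)%:E
    & forall T : nat, (1 <= T)%N -> Reg T <= 33 * Num.sqrt T%:R + Delta].
Proof.
move=> Delta Reg e.
have [b [other [bo mubo DeE]]] := best_arm mu.
have RegE T : Reg T = Delta * fine (\int[P]_w (draws (play (ucb T) (U w)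
    (fun i s => X i s w) T) other)%:R%:E)%E.
  by rewrite /Reg (regretE X U _ T bo mubo) ?/Delta ?DeE//; case: (hucb T).
have gap : 0 < Delta -> mu other < mu b by rewrite /Delta DeE subr_gt0.
have e2 : 2 <= e by exact: expR1_ge2.
split.
- move=> D0 T eps T1 /andP[eps0 epsD] TDe Teps.
  have mubo' := gap D0.
  have epsD' : eps < mu b - mu other by rewrite -DeE.
  have := other_draws_upper hbandit mubo' (hucb T) _ Teps.
  rewrite eps0 epsD' => /(_ isT).
  rewrite -DeE -/Delta => /(ler_wpM2l (ltW D0)); rewrite -RegE => /le_trans; apply.
  rewrite [eps ^+ 2 * _]mulrC.
  set L := Num.sqrt (ln (T%:R * eps ^+ 2)); have L0 : 0 <= L by exact: sqrtr_ge0.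
  set A := ln (T%:R * Delta ^+ 2 / 2); set sp := Num.sqrt (pi * A).
  have -> : Delta * ((48 * L + 24) / eps ^+ 2 + 1 +
      (2 * A + 2 + 2 * sp) / (Delta - eps) ^+ 2) =
      2 * A / (Delta * (1 - eps / Delta) ^+ 2) +
      2 * sp / (Delta * (1 - eps / Delta) ^+ 2) +
      Delta * ((48 * L + 24) / eps ^+ 2) +
      2 / (Delta * (1 - eps / Delta) ^+ 2) + Delta.
    by field; rewrite !gt_eqF//; lra.
  rewrite !lerD2r lerD2l ler_pM2l// ler_pM2r ?invr_gt0 ?exprn_gt0//.
  nra.
- move=> D0; have mubo' := gap D0.
  have lim : (Reg T / ln T%:R : R) @[T --> \oo] --> 2 / Delta.
    apply/cvgrPdist_le => eta eta0.
    (* The relative error that amounts to [eta] on the limit. *)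
    pose k := Num.min (eta * Delta / 2) (1 / 2).
    have k0 : 0 < k by rewrite lt_min !divr_gt0// mulr_gt0.
    have k1 : k <= 1 / 2 by rewrite ge_min lexx orbT.
    have ke : 2 / Delta * k <= eta.
      have : k <= eta * Delta / 2 by rewrite ge_min lexx.
      have : 0 < 2 / Delta by exact: divr_gt0.
      move=> c0 /(ler_wpM2l (ltW c0)) /le_trans; apply.
      by rewrite le_eqVlt; apply/orP; left; apply/eqP; field; rewrite gt_eqF.
    near=> T.
    have lo : 2 * (1 - k) / Delta ^+ 2 * ln T%:R <= Reg T / Delta.
      rewrite RegE [Delta * fine _]mulrC mulfK ?gt_eqF// /Delta DeE.
      have := hucb T; move: (ucb T); near: T.
      by apply: (near_expected_draws_lower hbandit) => //; lra.
    have hi : Reg T / Delta <= 2 * (1 + k) / Delta ^+ 2 * ln T%:R.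
      rewrite RegE [Delta * fine _]mulrC mulfK ?gt_eqF// /Delta DeE.
      have := hucb T; move: (ucb T); near: T.
      exact: (near_other_draws_upper hbandit).
    have u0 : 0 < ln (T%:R : R).
      rewrite -sqrtr_gt0 (@lt_le_trans _ _ 1)//.
      by near: T; exact: near_sqrt_ln.
    have lo' : 2 / Delta * (1 - k) <= Reg T / ln T%:R.
      rewrite ler_pdivlMr//; apply: le_trans (_ : _ <= 2 * (1 - k) /
        Delta ^+ 2 * ln T%:R * Delta) _; last by rewrite -ler_pdivlMr.
      by rewrite le_eqVlt; apply/orP; left; apply/eqP; field; rewrite gt_eqF.
    have hi' : Reg T / ln T%:R <= 2 / Delta * (1 + k).
      rewrite ler_pdivrMr//; apply: le_trans (_ : _ <= 2 * (1 + k) /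
        Delta ^+ 2 * ln T%:R * Delta) _; first by rewrite -ler_pdivrMr.
      by rewrite le_eqVlt; apply/orP; left; apply/eqP; field; rewrite gt_eqF.
    by rewrite ler_norml; lra.
  have limE : (Reg T / ln T%:R)%:E @[T --> \oo] --> (2 / Delta)%:E.
    by apply: cvg_EFin; [exact: nearW|exact: lim].
  by have [_ ->] := cvg_limn_einf_sup limE.
- move=> T T1; have [D0|D0] := ltP 0 Delta.
    by rewrite RegE /Delta DeE; apply: (other_draws_sqrt hbandit) => //; exact: gap.
  have D0' : Delta = 0 by apply/eqP; rewrite eq_le D0 normr_ge0.
  by rewrite RegE D0' mul0r addr0 mulr_ge0 ?sqrtr_ge0.
Unshelve. all: by end_near. Qed.
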